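(* The zero locus in $OG(2,11)$ of a general global section of the spinor bundle $\mathcal{S}$ is isomorphic to $Fl_5$.
   Context: Over $\mathbb{C}$. $OG(2,11)$ is the orthogonal Grassmannian of isotropic planes $U$ in $V=\mathbb{C}^{11}$ with a non-degenerate quadratic form. $\Delta$ is the $32$-dimensional spin representation of $Spin_{11}$, with Clifford action $V\otimes\Delta\to\Delta$. The spinor bundle $\mathcal{S}$ is the homogeneous bundle on $OG(2,11)$ of rank $8$ whose fiber at $[U]$ is the cokernel of $U\otimes\Delta\to\Delta$; $H^0(\mathcal{S})=\Delta$. $Fl_n$ denotes the adjoint variety of $SL_n$, i.e. the incidence variety of pairs (point, hyperplane containing it) in $\mathbb{P}^{n-1}\times\check{\mathbb{P}}^{n-1}$. *)

(* Defs.v *)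
From mathcomp Require Import all_boot all_order all_algebra.
From mathcomp Require Import boolp classical_sets functions.
From mathcomp Require Export reals complex.
From mathcomp Require Import mpoly ring.

Set Implicit Arguments.
Unset Strict Implicit.
Unset Printing Implicit Defensive.

Import GRing.Theory.
Local Open Scope classical_set_scope.
Local Open Scope ring_scope.

(** Schemes over a field [k] are represented by their functors of points
    A |-> X(A) on commutative k-algebras; by Yoneda an isomorphism of k-schemes
    is the same thing as a natural bijection between functors of points.  (The
    algebras of the library are nonzero; nothing is lost, since X(0) is a
    singleton for every scheme X.)  X(A) is given as a subset [pts A] of a type
    [amb A] of all candidates, and only the values on [pts A] matter. *)
Record kfunctor (k : fieldType) := KFunctor {
  amb : comAlgType k -> Type;
  pts : forall A : comAlgType k, set (amb A);
  bc : forall A B : comAlgType k, {lrmorphism A -> B} -> amb A -> amb B;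
  bc_pts : forall (A B : comAlgType k) (f : {lrmorphism A -> B}) x,
    pts x -> pts (bc f x);
  bc_id : forall (A : comAlgType k) (x : amb A), pts x ->
    bc (idfun : {lrmorphism A -> A}) x = x;
  bc_comp : forall (A B D : comAlgType k) (f : {lrmorphism A -> B})
      (g : {lrmorphism B -> D}) x, pts x ->
    bc (g \o f : {lrmorphism A -> D}) x = bc g (bc f x) }.

Arguments amb {k} X A : rename.
Arguments pts {k} X A : rename.
Arguments bc {k} X {A B} f x : rename.

Definition isomorphic (k : fieldType) (X Y : kfunctor k) : Prop :=
  exists phi : forall A : comAlgType k, amb X A -> amb Y A,
    (forall A : comAlgType k, set_bij (pts X A) (pts Y A) (phi A))
    /\ (forall (A B : comAlgType k) (f : {lrmorphism A -> B}) (x : amb X A),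
          pts X A x -> phi B (bc X f x) = bc Y f (phi A x)).

Section Submodules.
Variable A : comNzRingType.

Definition is_submodule n (W : set 'rV[A]_n) : Prop :=
  W 0 /\ (forall (a : A) u v, W u -> W v -> W (a *: u + v)).

Definition span n (S : set 'rV[A]_n) : set 'rV[A]_n :=
  smallest (@is_submodule n) S.

Definition rowspace m n (M : 'M[A]_(m, n)) : set 'rV[A]_n :=
  [set v *m M | v in [set: 'rV[A]_m]].

(** [U] is a direct summand of A^n of constant rank [r]: the image of an
    idempotent whose rank is [r] at every field-valued point of Spec A.
    These are the A-points of the Grassmannian G(r, n). *)
Definition grassmannian (r n : nat) (U : set 'rV[A]_n) : Prop :=
  exists P : 'M[A]_n, [/\ P *m P = P, U = rowspace P &
    forall (K : fieldType) (f : {rmorphism A -> K}), \rank (map_mx f P) = r].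

End Submodules.

(** For a direct summand U this is U (x)_A B, viewed inside B^n. *)
Definition base_change (A B : comNzRingType) (f : {rmorphism A -> B}) n
    (U : set 'rV[A]_n) : set 'rV[B]_n :=
  span [set map_mx f u | u in U].

Section SubmoduleTheory.
Variable A : comNzRingType.

Lemma span_submodule n (S : set 'rV[A]_n) : is_submodule (span S).
Proof.
split=> [W [[W0 _] _] //|a u v Su Sv W [WW SW]].
by apply: WW.2; [apply: Su | apply: Sv].
Qed.

Lemma sub_span n (S : set 'rV[A]_n) : S `<=` span S.
Proof. exact: sub_gen_smallest. Qed.

Lemma span_min n (S W : set 'rV[A]_n) :
  is_submodule W -> S `<=` W -> span S `<=` W.
Proof. by move=> WW SW; apply: smallest_sub. Qed.

Lemma submodule_sum n (W : set 'rV[A]_n) (I : Type) (r : seq I)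
    (a : I -> A) (w : I -> 'rV[A]_n) :
  is_submodule W -> (forall i, W (w i)) -> W (\sum_(i <- r) a i *: w i).
Proof.
move=> [W0 WD] Ww; elim: r => [|i r IH]; first by rewrite big_nil.
by rewrite big_cons; apply: (WD _ _ _ (Ww i) IH).
Qed.

Lemma rowspace_submodule m n (M : 'M[A]_(m, n)) : is_submodule (rowspace M).
Proof.
split; first by exists 0 => //; rewrite mul0mx.
move=> a _ _ [u _ <-] [v _ <-]; exists (a *: u + v) => //.
by rewrite mulmxDl scalemxAl.
Qed.

Lemma row_rowspace m n (M : 'M[A]_(m, n)) i : rowspace M (row i M).
Proof. by exists (delta_mx 0 i) => //; rewrite -rowE. Qed.

End SubmoduleTheory.

Lemma base_change_rowspace (A B : comNzRingType) (f : {rmorphism A -> B})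
    m n (M : 'M[A]_(m, n)) :
  base_change f (rowspace M) = rowspace (map_mx f M).
Proof.
apply/seteqP; split.
  apply: span_min; first exact: rowspace_submodule.
  by move=> _ [_ [v _ <-] <-]; exists (map_mx f v) => //; rewrite map_mxM.
move=> _ [v _ <-]; rewrite mulmx_sum_row.
apply: (submodule_sum (W := base_change f (rowspace M))); first exact: span_submodule.
move=> i; apply: sub_span; exists (row i M); first exact: row_rowspace.
by rewrite map_row.
Qed.

Lemma base_change_grassmannian (A B : comNzRingType) (f : {rmorphism A -> B})
    r n (U : set 'rV[A]_n) :
  grassmannian r U -> grassmannian r (base_change f U).
Proof.
move=> [P [PP -> rP]]; exists (map_mx f P); split.
- by rewrite -map_mxM PP.
- exact: base_change_rowspace.
- by move=> K g; rewrite -map_mx_comp; apply: (rP K (g \o f)).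
Qed.

Lemma base_change_id (A : comNzRingType) (f : {rmorphism A -> A}) r n
    (U : set 'rV[A]_n) :
  f =1 id -> grassmannian r U -> base_change f U = U.
Proof.
move=> f1 [P [_ -> _]]; rewrite base_change_rowspace; congr rowspace.
by apply/matrixP=> i j; rewrite mxE f1.
Qed.

Lemma base_change_comp (A B D : comNzRingType) (f : {rmorphism A -> B})
    (g : {rmorphism B -> D}) (h : {rmorphism A -> D}) r n (U : set 'rV[A]_n) :
  h =1 g \o f -> grassmannian r U ->
  base_change h U = base_change g (base_change f U).
Proof.
move=> hE [P [_ -> _]]; rewrite !base_change_rowspace; congr rowspace.
by apply/matrixP=> i j; rewrite !mxE hE.
Qed.

Section Flags.
Variables (k : fieldType) (n : nat).

(** Pairs of a point of P^(n-1), i.e. a line L in A^n, and a hyperplane H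
    containing it. *)
Definition Fl_pts (A : comAlgType k) : set (set 'rV[A]_n * set 'rV[A]_n) :=
  [set LH | [/\ grassmannian 1 LH.1, grassmannian n.-1 LH.2
              & LH.1 `<=` LH.2]].

Definition Fl_bc (A B : comAlgType k) (f : {lrmorphism A -> B})
    (LH : set 'rV[A]_n * set 'rV[A]_n) : set 'rV[B]_n * set 'rV[B]_n :=
  (base_change f LH.1, base_change f LH.2).

Lemma Fl_bc_pts (A B : comAlgType k) (f : {lrmorphism A -> B}) LH :
  Fl_pts LH -> Fl_pts (Fl_bc f LH).
Proof.
move=> [gL gH sLH]; split; [exact: base_change_grassmannian..|].
apply: span_min; first exact: span_submodule.
by move=> _ [u Lu <-]; apply: sub_span; exists u => //; apply: sLH.
Qed.

Lemma Fl_bc_id (A : comAlgType k) (LH : set 'rV[A]_n * set 'rV[A]_n) :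
  Fl_pts LH -> Fl_bc (idfun : {lrmorphism A -> A}) LH = LH.
Proof.
by case: LH => L H [/= gL gH _]; congr pair; apply: base_change_id; eauto.
Qed.

Lemma Fl_bc_comp (A B D : comAlgType k) (f : {lrmorphism A -> B})
    (g : {lrmorphism B -> D}) (LH : set 'rV[A]_n * set 'rV[A]_n) :
  Fl_pts LH -> Fl_bc (g \o f : {lrmorphism A -> D}) LH = Fl_bc g (Fl_bc f LH).
Proof.
by move=> [gL gH _]; congr pair; apply: base_change_comp; eauto.
Qed.

Definition Fl : kfunctor k := KFunctor Fl_bc_pts Fl_bc_id Fl_bc_comp.

End Flags.

Definition quad (A : comNzRingType) n (Q : 'M[A]_n) (v : 'rV[A]_n) : A :=
  (v *m Q *m v^T) 0 0.

(** Clifford multiplication by [v], given that by the basis vectors; it acts on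
    row vectors of the spin module from the right. *)
Definition cliff (A : comNzRingType) n N (gam : 'I_n -> 'M[A]_N)
    (v : 'rV[A]_n) : 'M[A]_N :=
  \sum_i v 0 i *: gam i.

(** [gam] makes k^N an irreducible module over the Clifford algebra of
    (k^n, quad Q), that is, v^2 = q(v).  For n odd and k algebraically closed
    there are two such modules up to isomorphism, with isomorphic restrictions
    to Spin_n: the spin representation. *)
Definition spin_module (k : fieldType) n N (Q : 'M[k]_n)
    (gam : 'I_n -> 'M[k]_N) : Prop :=
  (forall v : 'rV[k]_n, cliff gam v *m cliff gam v = (quad Q v)%:M) /\
  (forall W : 'M[k]_N, (forall v : 'rV[k]_n, stablemx W (cliff gam v)) ->
     W != 0 -> row_full W).

Section SpinorBundle.
Variables (k : fieldType) (n N : nat) (Q : 'M[k]_n) (gam : 'I_n -> 'M[k]_N).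

Definition gamA (A : comAlgType k) (i : 'I_n) : 'M[A]_N :=
  map_mx (in_alg A) (gam i).

Definition OG2 (A : comAlgType k) (U : set 'rV[A]_n) : Prop :=
  grassmannian 2 U /\
  (forall u, U u -> quad (map_mx (in_alg A) Q) u = 0).

(** The image of U (x) Delta -> Delta. *)
Definition cliff_image (A : comAlgType k) (U : set 'rV[A]_n) : set 'rV[A]_N :=
  span [set d *m cliff (@gamA A) u | u in U & d in [set: 'rV[A]_N]].

(** The spinor bundle is the cokernel of U (x) Delta -> Delta, whose formation
    commutes with base change; [delta] in Delta = H^0(S) vanishes at the A-point
    [U] iff its class in Delta_A / U.Delta_A is zero.  This is the
    scheme-theoretic zero locus. *)
Definition spinor_zero_pts (delta : 'rV[k]_N) (A : comAlgType k) :
    set (set 'rV[A]_n) :=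
  [set U | OG2 U /\ cliff_image U (map_mx (in_alg A) delta)].

Definition spinor_zero_bc (A B : comAlgType k) (f : {lrmorphism A -> B})
  (U : set 'rV[A]_n) : set 'rV[B]_n := base_change f U.

Lemma map_in_alg (A B : comAlgType k) (f : {lrmorphism A -> B}) p q
    (M : 'M[k]_(p, q)) :
  map_mx f (map_mx (in_alg A) M) = map_mx (in_alg B) M.
Proof. by apply/matrixP=> i j; rewrite !mxE rmorph_alg. Qed.

Lemma map_quad (A B : comNzRingType) (f : {rmorphism A -> B})
    (G : 'M[A]_n) (v : 'rV[A]_n) :
  quad (map_mx f G) (map_mx f v) = f (quad G v).
Proof. by rewrite /quad map_trmx -!map_mxM mxE. Qed.

Lemma quad_sum (A : comNzRingType) (G : 'M[A]_n) m (w : 'I_m -> 'rV[A]_n)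
    (a : 'I_m -> A) :
  (forall i, quad G (w i) = 0) -> (forall i j, quad G (w i + w j) = 0) ->
  quad G (\sum_i a i *: w i) = 0.
Proof.
move=> q0 qD0.
pose bil (u v : 'rV[A]_n) : A := (u *m G *m v^T) 0 0.
have DE (X Y : 'M[A]_1) : (X + Y) 0 0 = X 0 0 + Y 0 0 by rewrite mxE.
have ZE c (X : 'M[A]_1) : (c *: X) 0 0 = c * X 0 0 by rewrite mxE.
have qE u v : quad G (u + v) = quad G u + quad G v + (bil u v + bil v u).
  by rewrite /quad /bil linearD /= !mulmxDl !mulmxDr !DE; ring.
have qZ c u : quad G (c *: u) = c * (c * quad G u).
  by rewrite /quad linearZ /= -!(scalemxAl, scalemxAr) !ZE.
have bDl u v z : bil (u + v) z = bil u z + bil v z.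
  by rewrite /bil !mulmxDl DE.
have bDr u v z : bil z (u + v) = bil z u + bil z v.
  by rewrite /bil linearD /= !mulmxDr DE.
have bZl c u z : bil (c *: u) z = c * bil u z.
  by rewrite /bil -!scalemxAl ZE.
have bZr c u z : bil z (c *: u) = c * bil z u.
  by rewrite /bil linearZ /= -!scalemxAr ZE.
have p0 i j : bil (w i) (w j) + bil (w j) (w i) = 0.
  by have := qE (w i) (w j); rewrite qD0 !q0 !add0r => <-.
pose W v := quad G v = 0 /\ forall i, bil v (w i) + bil (w i) v = 0.
suff [] : W (\sum_i a i *: w i) by [].
elim/big_rec: _ => [|i v _ [qv pv]].
  by split=> [|i]; rewrite /bil /quad !(mul0mx, trmx0, mulmx0) !mxE ?addr0.
split=> [|j].
  by rewrite qE qZ q0 qv bZl bZr -mulrDr addrC (addrC (bil _ _)) pv !mulr0 !addr0.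
by rewrite bDl bDr bZl bZr addrACA -mulrDr p0 pv mulr0 addr0.
Qed.

Lemma spinor_zero_bc_pts (delta : 'rV[k]_N) (A B : comAlgType k)
    (f : {lrmorphism A -> B}) U :
  spinor_zero_pts delta U -> spinor_zero_pts delta (spinor_zero_bc f U).
Proof.
move=> [[gU isoU] dU]; split; first split.
- exact: base_change_grassmannian.
- have [P [_ UE _]] := gU.
  rewrite /spinor_zero_bc {1}UE base_change_rowspace => _ [v _ <-].
  have UP i : U (row i P) by rewrite UE; apply: row_rowspace.
  have UD u u' : U u -> U u' -> U (u + u').
    rewrite UE => Pu Pu'; rewrite -[u]scale1r.
    by apply: (rowspace_submodule P).2.
  rewrite mulmx_sum_row -(map_in_alg f); apply: quad_sum => [i|i j].
    by rewrite -map_row map_quad isoU ?rmorph0.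
  by rewrite -!map_row -map_mxD map_quad isoU ?rmorph0 //; apply: UD.
- rewrite -(map_in_alg f).
  apply: (span_min (W := [set d | cliff_image (spinor_zero_bc f U)
                                    (map_mx f d)])) dU.
    have [W0 WD] := span_submodule
      [set d *m cliff (@gamA B) u | u in spinor_zero_bc f U
                                  & d in [set: 'rV[B]_N]].
    split=> [|a u v Wu Wv] /=; first by rewrite map_mx0.
    by rewrite map_mxD map_mxZ; apply: WD.
  move=> _ [u Uu [d _ <-]] /=; apply: sub_span; exists (map_mx f u).
    by apply: sub_span; exists u.
  exists (map_mx f d) => //; rewrite map_mxM; congr (_ *m _).
  rewrite /cliff raddf_sum; apply: eq_bigr => i _ /=.
  by rewrite map_mxZ map_in_alg mxE.
Qed.

Lemma spinor_zero_bc_id (delta : 'rV[k]_N) (A : comAlgType k) U :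
  spinor_zero_pts delta U ->
  spinor_zero_bc (idfun : {lrmorphism A -> A}) U = U.
Proof. by move=> [[gU _] _]; apply: base_change_id gU. Qed.

Lemma spinor_zero_bc_comp (delta : 'rV[k]_N) (A B D : comAlgType k)
    (f : {lrmorphism A -> B}) (g : {lrmorphism B -> D}) U :
  spinor_zero_pts delta U ->
  spinor_zero_bc (g \o f : {lrmorphism A -> D}) U =
  spinor_zero_bc g (spinor_zero_bc f U).
Proof. by move=> [[gU _] _]; apply: base_change_comp gU. Qed.

Definition spinor_zero (delta : 'rV[k]_N) : kfunctor k :=
  KFunctor (@spinor_zero_bc_pts delta) (@spinor_zero_bc_id delta)
           (@spinor_zero_bc_comp delta).

End SpinorBundle.

Definition zariski_open (k : fieldType) N (D : set 'rV[k]_N) : Prop :=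
  exists I : set {mpoly k[N]},
    D = [set x | exists2 F, I F & F.@[fun i => x 0 i] != 0].

Definition for_general (k : fieldType) N (P : 'rV[k]_N -> Prop) : Prop :=
  exists D : set 'rV[k]_N,
    [/\ zariski_open D, D !=set0 & forall x, D x -> P x].

(* Main.v *)
From HB Require Import structures.
Require Import Defs.
From mathcomp Require Import all_boot all_order all_algebra.
From mathcomp Require Import boolp classical_sets ring_quotient mpoly ring.

Set Implicit Arguments.
Unset Strict Implicit.
Unset Printing Implicit Defensive.

Import GRing.Theory Num.Theory.
Local Open Scope ring_scope.
Local Open Scope complex_scope.

(** Write a general spinor as delta = s1 + s2 with s1, s2 pure spinors, whose
    annihilators in V are isotropic 5-spaces <a>, <b> in perfect duality, so that
    V = <a> + <b> + <e>.  If U is an isotropic plane with delta in U.Delta, then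
    delta.u.v = 0 for u, v in U.  Expanding this in the basis of Delta given by
    products of the b's applied to s1, the terms coming from s1 and s2 do not
    interact, and they say that the projections of U to <a>, <b> and <e> have rank
    1, 1 and 0.  So U = L + M with L in <a>, M in <b>, and isotropy means that M is
    orthogonal to L: the pair (L, M^perp) is a point of Fl_5.  Conversely s1 is in
    L.Delta and s2 in M.Delta.  All of this works over an arbitrary C-algebra,
    because the only facts needed about a projector P of constant rank r are that
    its trace is r and that its (r+1)-minors vanish.

    That a general spinor is a sum of two pure ones is made explicit by writing it
    as (x0, B, C, y0) with B, C skew 6x6 matrices: pure spinors are the multiples of
    (1, X, X#, Pf X), and the decomposition amounts to a quadratic equation whose
    discriminant is essentially the invariant quartic. *)

(** * Projectors of constant rank *)

(** The rank of a projector P is prescribed only at field-valued points, while A may have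
    nilpotents, so an identity checked at such points does not follow over A. The trace and the
    minors are still exact because the polynomial det(1 - P + X P) is multiplicative in X. From a
    point of the zero locus, a field-valued point is used only to see that an annihilator is the
    unit ideal; characteristic zero enters there.

    The relation delta.u.v = 0 comes from u.v.w = 0 for u, v, w in U: this product is alternating,
    and three vectors of a rank 2 module have vanishing 3-minors. The component along e then
    disappears by a trace computation that yields 2 c = c.

    Lines and hyperplanes over A need not be free, so no generator of L or M is ever chosen. Every
    construction goes through projectors, and this also makes compatibility with base change
    visible. *)

Section ResidueField.
Local Open Scope quotient_scope.
Variables (A : comNzRingType) (I : idealr A).
Hypothesis maxI : forall x : A, x \notin I -> exists y, x * y - 1 \in I.

Definition residue_field := {ideal_quot I}.
HB.instance Definition _ := GRing.ComNzRing.on residue_field.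

Definition residue_inv (x : residue_field) : residue_field :=
  if pselect (exists y, y * x = 1) is left e then projT1 (cid e) else 0.

Lemma residue_mulVx (x : residue_field) : x != 0 -> residue_inv x * x = 1.
Proof.
rewrite /residue_inv; case: pselect => [e _|ne nx]; first exact: projT2 (cid e).
case: ne; have /maxI [y xy] : repr x \notin I.
  apply: contraNN nx => xI; rewrite -[x]reprK -[0](rmorph0 (\pi_{ideal_quot I})).
  by rewrite -Quotient.idealrBE subr0.
exists (\pi_{ideal_quot I} y); rewrite -{1}[x]reprK.
rewrite -[1](rmorph1 (\pi_{ideal_quot I})).
apply: etrans (esym (rmorphM (\pi_{ideal_quot I}) _ _)) _; apply/eqP.
by rewrite -Quotient.idealrBE mulrC.
Qed.

Lemma residue_inv0 : residue_inv 0 = 0.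
Proof.
rewrite /residue_inv; case: pselect => // e; have [y /eqP] := e.
by rewrite mulr0 eq_sym oner_eq0.
Qed.

HB.instance Definition _ :=
  GRing.ComNzRing_isField.Build residue_field residue_mulVx residue_inv0.
Definition residue_fieldType : fieldType := residue_field.
Definition residue_map : {rmorphism A -> residue_fieldType} :=
  \pi_{ideal_quot I}.

Lemma residue_map_eq0 x : x \in I -> residue_map x = 0.
Proof.
move=> xI; rewrite -(rmorph0 residue_map); apply/eqP.
by rewrite -[_ == _]Quotient.idealrBE subr0.
Qed.
End ResidueField.

Lemma maximal_ideal (A : comNzRingType) (I : set A) :
  I 0 -> ~ I 1 -> (forall a u v, I u -> I v -> I (a * u + v)) ->
  exists m : idealr A, (forall x, I x -> x \in m) /\
    forall x, x \notin m -> exists y, x * y - 1 \in m.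
Proof.
move=> I0 I1 IP.
(* Zorn's lemma is used for unions of chains, the empty chain included, so the empty set must be
   admissible. Hence the condition is put on [J B], the union of B with I. *)
pose J (B : set A) : set A := fun x => B x \/ I x.
pose P (B : set A) := ~ J B 1 /\ forall a u v, J B u -> J B v -> J B (a * u + v).
have [|B [[J1 JP] Bmax]] := @Zorn_bigcup _ P.
  move=> F FP Ft; split=> [[[B FB B1]|//]|a u v].
    by have [+ _] := FP _ FB; apply; left.
  case=> [[B FB Bu]|Iu] [[C FC Cv]|Iv].
  - have [BC|CB] := Ft _ _ FB FC.
      have [_ /(_ a u v)] := FP _ FC; case; [by left; apply: BC|by left| |by right].
      by move=> ?; left; exists C.
    have [_ /(_ a u v)] := FP _ FB; case; [by left|by left; apply: CB| |by right].
    by move=> ?; left; exists B.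
  - have [_ /(_ a u v)] := FP _ FB; case; [by left|by right| |by right].
    by move=> ?; left; exists B.
  - have [_ /(_ a u v)] := FP _ FC; case; [by right|by left| |by right].
    by move=> ?; left; exists C.
  - by right; apply: IP.
pose S : {pred A} := fun x => `[< J B x >].
have SE x : (x \in S) = `[< J B x >] by [].
have Sid : idealr_closed S.
  split; rewrite ?SE; first by apply/asboolP; right.
    by apply/asboolP.
  by move=> a u v; rewrite !SE => /asboolP Bu /asboolP Bv; apply/asboolP/JP.
pose Sm := isIdealr.Build A S Sid.
pose m : idealr A := HB.pack S Sm.
exists m; split=> [x Ix|x]; first by rewrite (SE x : (x \in m) = _);
  apply/asboolP; right.
rewrite (SE x : (x \in m) = _) => /asboolP nJx.
(* [C] is the ideal generated by [J B] and x. By maximality it contains 1, and 1 = x y + u exhibits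
   y as an inverse of x modulo the ideal. *)
pose C : set A := fun z => exists y u, J B u /\ z = x * y + u.
have JC z : J C z -> C z.
  by case=> // Iz; exists 0, z; split; [right|rewrite mulr0 add0r].
have BC z : J B z -> C z by move=> Jz; exists 0, z; split; rewrite ?mulr0 ?add0r.
have BltC : (B `<` C)%classic.
  split; first by move=> z Bz; apply: BC; left.
  move=> /(_ x) CB; apply: nJx; left; apply: CB.
  by exists 1, 0; split; [right|rewrite mulr1 addr0].
have := Bmax _ BltC; apply: contra_notP => nex; split.
  move=> /JC [y [u [Ju E]]]; apply: nex; exists y.
  rewrite (SE _ : (_ \in m) = _); apply/asboolP.
  have -> : x * y - 1 = (-1) * u + 0 by rewrite [in LHS]E; ring.
  by apply: JP => //; right.
move=> a u v /JC [y [b [Jb ->]]] /JC [y' [b' [Jb' ->]]]; left.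
exists (a * y + y'), (a * b + b'); split; first exact: JP.
by ring.
Qed.

(** The condition in [grassmannian] speaks only of maps to fields; this supplies such a map, killing
    a given proper ideal. *)
Lemma field_point (A : comNzRingType) (I : set A) :
  I 0 -> ~ I 1 -> (forall a u v, I u -> I v -> I (a * u + v)) ->
  exists (K : fieldType) (f : {rmorphism A -> K}), forall x, I x -> f x = 0.
Proof.
move=> I0 I1 IP; have [m [Im maxm]] := maximal_ideal I0 I1 IP.
exists (residue_fieldType maxm), (residue_map maxm) => x Ix.
exact/residue_map_eq0/Im.
Qed.

(** Sylvester's determinant identity. Multiplying the block matrix [B] by two different triangular
    matrices computes its determinant twice; the powers of x avoid inverting x. *)
Lemma det_add_mulC (A : comNzRingType) n m (x : A) (C : 'M_(n, m)) (D : 'M_(m, n)) :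
  x ^+ m * \det (x%:M + C *m D) = x ^+ n * \det (x%:M + D *m C).
Proof.
pose B := block_mx x%:M C (- D) (1%:M : 'M[A]_m).
have BE : \det B = \det (x%:M + C *m D).
  rewrite -[LHS]mulr1 -(_ : \det (block_mx 1%:M 0 D 1%:M : 'M[A]_(n + m)) = 1).
    rewrite -det_mulmx mulmx_block !mulmx1 !mul1mx !mulmx0 !add0r.
    by rewrite addNr det_ublock det1 mulr1.
  by rewrite det_lblock !det1 mulr1.
rewrite -BE -(det_scalar m x) -[\det x%:M]mul1r -(det1 A n) -(det_lblock _ D).
rewrite -det_mulmx mulmx_block !mul1mx !mul0mx !addr0 mulmx1 mul_scalar_mx.
by rewrite scalerN mul_mx_scalar subrr det_ublock det_scalar addrC.
Qed.

(** In a rank factorisation P = C D, the factor C is left invertible and D is right invertible, so C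
    D C D = C D forces D C = 1. *)
Lemma idempotent_split (K : fieldType) n (P : 'M[K]_n) : P *m P = P ->
  exists (C : 'M_(n, \rank P)) (D : 'M_(\rank P, n)), P = C *m D /\ D *m C = 1%:M.
Proof.
move=> PP; exists (col_base P), (row_base P); split; first by rewrite mulmx_base.
have /row_fullP [C' C'C] := col_base_full P.
have /row_freeP [D' DD'] := row_base_free P.
have CD := mulmx_base P; move: C' D' (col_base P) (row_base P) C'C DD' CD.
move: (\rank P) => r C' D' C D C'C DD' CD.
have -> : D *m C = C' *m ((C *m D) *m (C *m D)) *m D'.
  by rewrite !mulmxA C'C mul1mx -!mulmxA DD' mulmx1.
by rewrite CD PP -CD !mulmxA C'C mul1mx.
Qed.

Lemma mxtrace_idempotent (K : fieldType) n (P : 'M[K]_n) :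
  P *m P = P -> \tr P = (\rank P)%:R.
Proof.
by move=> /idempotent_split [C [D [PE DC]]]; rewrite {1}PE mxtrace_mulC DC mxtrace1.
Qed.

Lemma det_1D_idempotent (K : fieldType) n (P : 'M[K]_n) :
  P *m P = P -> \det (1%:M + P) = 2 ^+ (\rank P).
Proof.
move=> /idempotent_split [C [D [PE DC]]].
have := det_add_mulC 1 C D; rewrite -PE DC !expr1n !mul1r => ->.
by rewrite -raddfD det_scalar.
Qed.

Lemma natr_inj (K : fieldType) : [pchar K] =i pred0 ->
  injective (fun m => m%:R : K).
Proof.
move=> /pcharf0P K0; suff lt m m' : (m < m')%N -> m%:R <> m'%:R :> K.
  by move=> m m'; case: (ltngtP m m') => // /lt // mm' /esym.
move=> lt /eqP; rewrite eq_sym -subr_eq0 -natrB ?(ltnW lt) //.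
by rewrite K0 subn_eq0 leqNgt lt.
Qed.

Section ConstantRank.
Variables (k : fieldType) (A : comAlgType k) (n r : nat) (P : 'M[A]_n).
Hypothesis k0 : [pchar k] =i pred0.

Lemma natr_unit m : (0 < m)%N -> exists y : A, m%:R * y = 1.
Proof.
move=> m0; exists (in_alg A m%:R^-1).
have /pcharf0P k0' := k0.
by rewrite -(rmorph_nat (in_alg A)) -rmorphM /= mulfV ?scale1r // k0' -lt0n.
Qed.

Lemma pchar_point (K : fieldType) (f : {rmorphism A -> K}) : [pchar K] =i pred0.
Proof. by move=> p; rewrite (fmorph_pchar (f \o in_alg A)) k0. Qed.

Hypothesis PP : P *m P = P.
Hypothesis rP : forall (K : fieldType) (f : {rmorphism A -> K}),
  \rank (map_mx f P) = r.

(** Determinant of multiplication by X on the image of P, extended by the identity on the kernel. It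
    should be X^r, as an identity in A[X] and not merely at field-valued points. *)
Local Notation g := (\det (1%:M - map_mx polyC P + 'X *: map_mx polyC P)).

Lemma map_polyC_idempotent : map_mx polyC P *m map_mx polyC P = map_mx polyC P.
Proof. by rewrite -map_mxM PP. Qed.

Lemma idempotent_combM (B : comNzRingType) (E : 'M[B]_n) (a b c d : B) :
  E *m E = E ->
  (a *: (1%:M - E) + b *: E) *m (c *: (1%:M - E) + d *: E) =
  (a * c) *: (1%:M - E) + (b * d) *: E.
Proof.
move=> EE; have E1 : E *m (1%:M - E) = 0 by rewrite mulmxBr mulmx1 EE subrr.
have E2 : (1%:M - E) *m E = 0 by rewrite mulmxBl mul1mx EE subrr.
have E3 : (1%:M - E) *m (1%:M - E) = 1%:M - E by rewrite mulmxBr mulmx1 E2 subr0.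
rewrite mulmxDl !mulmxDr -!scalemxAl -!scalemxAr EE E1 E2 E3 !scaler0 addr0 add0r.
by rewrite !scalerA.
Qed.

Lemma comp_poly_scale (B : comNzRingType) (p : {poly B}) c i :
  (p \Po (c *: 'X))`_i = c ^+ i * p`_i.
Proof.
rewrite comp_polyE coef_sum (eq_bigr (fun j : 'I_(size p) =>
   (i == j)%:R * (c ^+ i * p`_i))); last first.
  move=> j _; rewrite coefZ exprZn coefZ coefXn.
  by case: eqP => [->|_]; rewrite ?mulr0 ?mul0r // mulr1 mul1r mulrC.
have [lt|le] := ltnP i (size p).
  rewrite (bigD1 (Ordinal lt)) //= eqxx mul1r big1 ?addr0 // => j.
  by rewrite -val_eqE /= eq_sym => /negPf ->; rewrite mul0r.
rewrite nth_default // mulr0 big1 // => j _; rewrite mulr0 //.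
Qed.

(* The polynomial g satisfies g(2X) = g(2) g(X), so 2^i - g(2) kills its i-th
   coefficient; at every field-valued point this scalar is 2^i - 2^r. *)
Lemma det_idempotent_coef i : i != r -> g`_i = 0.
Proof.
move=> ir.
have gE : g \Po (2 *: 'X) = (\det (1%:M + P))%:P * g.
  rewrite -[g \Po _]/(comp_poly _ _) -det_map_mx -det_map_mx -det_mulmx.
  have := idempotent_combM 1 2 1 'X map_polyC_idempotent;
    rewrite mul1r !scale1r => E.
  rewrite !map_mxD map_mxN !map_mx1 /=.
  have -> : 1%:M + map_mx polyC P = (1%:M - map_mx polyC P) + 2 *: map_mx polyC P.
    by rewrite scaler_nat mulr2n addrA subrK.
  rewrite E; congr (\det (_ - _ + _)).
  - by apply/matrixP=> a b; rewrite !mxE /= comp_polyC.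
  - apply/matrixP=> a b; rewrite !mxE /= comp_polyM comp_polyX comp_polyC.
    by rewrite -mul_polyC polyC_natr.
set z := g`_i.
have zE : (2 ^+ i - \det (1%:M + P)) * z = 0.
  have := congr1 (fun p : {poly A} => p`_i) gE.
  by rewrite comp_poly_scale coefCM mulrBl => ->; rewrite subrr.
apply: contrapT => z0.
(* The annihilator of a nonzero coefficient is a proper ideal; a field-valued point killing it would
   give 2^i = 2^r in characteristic zero. *)
have [| | |K [f fI]] := @field_point A [set x | x * z = 0]%classic.
- by rewrite /= mul0r.
- by rewrite /= mul1r.
- by move=> a u v /= uz vz; rewrite mulrDl -mulrA uz vz mulr0 addr0.
have := fI _ zE; rewrite rmorphB rmorphXn rmorph_nat -det_map_mx map_mxD map_mx1.
rewrite det_1D_idempotent -?map_mxM ?PP // rP -!natrX => /eqP.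
rewrite subr_eq0 => /eqP /(natr_inj (pchar_point f)) /(@expnI 2 isT) E.
by rewrite E eqxx in ir.
Qed.

(** A single coefficient is left, and it equals g(1) = det 1 = 1. *)
Lemma det_idempotent : g = 'X^r.
Proof.
have gE : g = g`_r *: 'X^r.
  apply/polyP=> i; rewrite coefZ coefXn; case: eqP => [->|/eqP ir].
    by rewrite mulr1.
  by rewrite mulr0 det_idempotent_coef.
have := congr1 (fun p : {poly A} => p.[1]) gE.
rewrite hornerZ hornerXn expr1n mulr1 => gr.
rewrite gE -gr.
rewrite -[g.[1]]/(horner_eval 1 _) -det_map_mx map_mxD map_mxZ map_mxB map_mx1.
by rewrite /= /horner_eval hornerX scale1r subrK det1 scale1r.
Qed.

(** The product of X (1 - P) + P and (1 - P) + X P is the scalar X, so [g] determines the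
    determinant of the complementary projector. *)
Lemma det_idempotent_compl : \det ('X *: (1%:M - map_mx polyC P) + map_mx polyC
  P) * 'X^r = 'X^n.
Proof.
rewrite -det_idempotent -det_mulmx.
have := idempotent_combM 'X 1 1 'X map_polyC_idempotent;
  rewrite mulr1 mul1r !scale1r => ->.
by rewrite -scalerDr subrK scalemx1 det_scalar.
Qed.

Lemma idempotent_rank_le : (r <= n)%N.
Proof.
rewrite leqNgt; apply/negP => lt.
have := congr1 (fun p : {poly A} => p`_n) det_idempotent_compl.
by rewrite coefMXn lt coefXn eqxx => /esym /eqP; rewrite oner_eq0.
Qed.

Lemma det_idempotent_complE :
  \det ('X *: (1%:M - map_mx polyC P) + map_mx polyC P) = 'X^(n - r).
Proof.
apply/polyP=> i; have := congr1 (fun p : {poly A} =>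
  p`_(i + r)) det_idempotent_compl.
rewrite coefMXn ltnNge leq_addl /= addnK => ->.
by rewrite !coefXn -(eqn_add2r r i) subnK // idempotent_rank_le.
Qed.

(** X - P is the product of X (1 - P) + P and (1 - P) + (X - 1) P, and the second determinant is [g]
    evaluated at X - 1. *)
Lemma char_poly_idempotent : char_poly P = 'X^(n - r) * ('X - 1) ^+ r.
Proof.
have := congr1 (comp_poly ('X - 1)) det_idempotent.
rewrite comp_Xn_poly -det_map_mx => <-; rewrite -det_idempotent_complE -det_mulmx.
have := idempotent_combM 'X 1 1 ('X - 1) map_polyC_idempotent;
  rewrite mulr1 mul1r !scale1r => E.
rewrite /char_poly; congr (\det _).
have -> : map_mx (comp_poly ('X - 1)) (1%:M - map_mx polyC P + 'X *: map_mx polyC P)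
   = 1%:M - map_mx polyC P + ('X - 1) *: map_mx polyC P.
  rewrite map_mxD map_mxB map_mx1; congr (_ - _ + _).
    by apply/matrixP=> a b; rewrite !mxE /= comp_polyC.
  by apply/matrixP=> a b; rewrite !mxE /= comp_polyM comp_polyX comp_polyC.
rewrite E /char_poly_mx scalerBl scalerBr scale1r addrA subrK.
by rewrite scalemx1.
Qed.

Lemma mxtrace_constant_rank : \tr P = r%:R.
Proof.
have rn := idempotent_rank_le.
case: (posnP n) => [n0|n_gt0].
  have -> : r = 0%N by apply/eqP; rewrite -leqn0 -n0.
  by rewrite /mxtrace big1 // => i; have := ltn_ord i; rewrite {2}n0.
apply: oppr_inj; rewrite -char_poly_trace // char_poly_idempotent coefXnM.
case: (posnP r) => [->|r_gt0].
  by rewrite subn0 ltn_predL n_gt0 oppr0.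
(* Reading this power as the characteristic polynomial of the identity of size r lets the same
   coefficient formula produce r. *)
have -> : ('X - 1) ^+ r = char_poly (1%:M : 'M[A]_r).
  by rewrite /char_poly /char_poly_mx map_mx1 -raddfB det_scalar.
have -> : (n.-1 < n - r)%N = false.
  by apply/negbTE; rewrite -leqNgt -ltnS prednK // ltn_subrL r_gt0 n_gt0.
have -> : (n.-1 - (n - r) = r.-1)%N.
  by rewrite -subn1 subnAC subKn ?subn1.
by rewrite char_poly_trace // mxtrace1.
Qed.

(** With G = P C D P, the determinant of X + G is X^(n-r) times that of 1 - P + X P + G, because G
    absorbs P on the right. Sylvester's identity turns this into: X^(m-r) divides det(X + D P C).
    Setting X = 0 gives the claim. *)
Lemma minor_constant_rank m (C : 'M[A]_(n, m)) (D : 'M[A]_(m, n)) :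
  (r < m)%N -> \det (D *m P *m C) = 0.
Proof.
move=> rm; have rn := idempotent_rank_le.
pose E := map_mx polyC P; pose G := map_mx polyC (P *m C *m D *m P).
have EE : E *m E = E := map_polyC_idempotent.
have GE : G *m ('X *: (1%:M - E) + E) = G.
  rewrite mulmxDr -scalemxAr mulmxBr mulmx1.
  have -> : G *m E = G by rewrite /G -map_mxM -(mulmxA _ P P) PP.
  by rewrite subrr scaler0 add0r.
have F : \det (1%:M - E + 'X *: E + G) * 'X^(n - r) = \det ('X%:M + G).
  rewrite -det_idempotent_complE -det_mulmx mulmxDl GE; congr (\det (_ + _)).
  have := idempotent_combM 1 'X 'X 1 EE; rewrite mulr1 mul1r !scale1r => ->.
  by rewrite -scalerDr subrK scalemx1.
have := det_add_mulC 'X (map_mx polyC (P *m C)) (map_mx polyC (D *m P)).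
rewrite -!map_mxM !mulmxA -(mulmxA D P P) PP -/G -F => {}F.
have {}F : 'X^(m - r) * \det (1%:M - E + 'X *: E + G) =
    \det ('X%:M + map_mx polyC (D *m P *m C)).
  apply: (monic_rreg (monicXn A n)); rewrite /= [RHS]mulrC -F mulrA mulrAC.
  rewrite [in RHS]mulrAC -!exprD; congr (_ ^+ _ * _).
  by rewrite addnBA // addnBAC // ltnW.
have := congr1 (fun p : {poly A} => p.[0]) F.
rewrite hornerM hornerXn -(subnSK rm) expr0n /= mul0r.
rewrite -[X in _ = X -> _]/(horner_eval 0 _) -det_map_mx map_mxD => ->.
rewrite map_scalar_mx /= /horner_eval hornerX raddf0 add0r; congr (\det _).
by apply/matrixP=> a b; rewrite [RHS]mxE [in RHS]mxE /= hornerC.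
Qed.

End ConstantRank.

(** * Planes with projections of rank at most one *)

Section SplitPlane.
Variables (A : comNzRingType) (m n : nat).

(** Obvious for a column times a row; the vanishing of the 2-minors gives the same identity
    entrywise when no such factorisation is available over A. *)
Lemma mulmx_minors p q (M : 'M[A]_(p, q)) (Y : 'M[A]_(q, p)) :
  (forall i j l l', M i l * M j l' = M i l' * M j l) ->
  M *m Y *m M = \tr (Y *m M) *: M.
Proof.
move=> minM; apply/matrixP=> i l; rewrite !mxE /mxtrace.
under eq_bigr => j _ do rewrite !mxE mulr_suml.
rewrite exchange_big /= mulr_suml; apply: eq_bigr => l' _.
rewrite !mxE mulr_suml; apply: eq_bigr => j _.
by rewrite mulrAC minM -mulrA mulrC; congr (_ * _); rewrite mulrC.
Qed.

Variables (a b : 'M[A]_(m, n)) (e : 'M[A]_(1, n)).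
Variables (Sa Sb : 'M[A]_(n, m)) (Sc : 'M[A]_(n, 1)).
Hypotheses (aSa : a *m Sa = 1%:M) (bSb : b *m Sb = 1%:M).
Hypotheses (aSb : a *m Sb = 0) (bSa : b *m Sa = 0).
Hypothesis S1 : Sa *m a + Sb *m b + Sc *m e = 1%:M.
Variable h : A.
Hypothesis h2 : h * 2 = 1.
Variable P : 'M[A]_n.
Hypotheses (PP : P *m P = P) (trP : \tr P = 2).

Local Notation M := (P *m Sa).
Local Notation N := (P *m Sb).
Local Notation c := (P *m Sc).

Hypothesis cM : forall i j l, c i 0 * M j l = c j 0 * M i l.
Hypothesis cN : forall i j l, c i 0 * N j l = c j 0 * N i l.
Hypothesis minM : forall i j l l', M i l * M j l' = M i l' * M j l.
Hypothesis minN : forall i j l l', N i l * N j l' = N i l' * N j l.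

Lemma plane_coord : P = M *m a + N *m b + c *m e.
Proof. by rewrite -!mulmxA -!mulmxDr S1 mulmx1. Qed.

Lemma mul2_eq0 (x : A) : 2 * x = 0 -> x = 0.
Proof. by move=> x0; rewrite -[x]mul1r -h2 -mulrA x0 mulr0. Qed.

(** All coordinates of P being proportional to c, one gets c_i P_jl = c_j P_il. Contracting j with l
    gives tr(P) c = P c = c, and tr(P) = 2. *)
Lemma plane_c0 : c = 0.
Proof.
have cP i j l : c i 0 * P j l = c j 0 * P i l.
  have E j' : P j' l = \sum_q M j' q * a q l + \sum_q N j' q * b q l + c j' 0 *
    e 0 l.
    rewrite [LHS](congr1 (fun X : 'M_n => X j' l) plane_coord) 2!mxE.
    by rewrite [(_ *m a) _ _]mxE [(_ *m b) _ _]mxE [(_ *m e) _ _]mxE big_ord1.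
  rewrite (E j) (E i) !mulrDr !mulr_sumr; congr (_ + _ + _); last by ring.
    by apply: eq_bigr => q _; rewrite !mulrA cM.
  by apply: eq_bigr => q _; rewrite !mulrA cN.
apply/matrixP=> i j; rewrite (ord1 j) [RHS]mxE.
have : \sum_j c i 0 * P j j = \sum_j c j 0 * P i j by apply: eq_bigr => l _.
rewrite -mulr_sumr -/(\tr P) trP => E.
have : (P *m c) i 0 = \sum_l c l 0 * P i l.
  by rewrite mxE; apply: eq_bigr => l _; rewrite mulrC.
rewrite mulmxA PP -E => cE.
have -> : c i 0 = c i 0 * 2 - c i 0 by ring.
by rewrite -cE subrr.
Qed.

Lemma plane_split : P = M *m a + N *m b.
Proof. by rewrite {1}plane_coord plane_c0 mul0mx addr0. Qed.

(* X = M a P and Y = N b P satisfy X + Y = P, X^2 = x X, Y^2 = y Y and x + y = 2,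
   whence (1 - y) P = 0. *)
Lemma plane_traces : \tr (a *m M) = 1 /\ \tr (b *m N) = 1.
Proof.
set x := \tr _; set y := \tr _.
have MaM : M *m a *m M = x *: M by apply: mulmx_minors.
have NbN : N *m b *m N = y *: N by apply: mulmx_minors.
pose X := M *m a *m P; pose Y := N *m b *m P.
have XX : X *m X = x *: X.
  by move: MaM; rewrite /X !mulmxA -(mulmxA _ P P) PP => ->; rewrite -!scalemxAl.
have YY : Y *m Y = y *: Y.
  by move: NbN; rewrite /Y !mulmxA -(mulmxA _ P P) PP => ->; rewrite -!scalemxAl.
have XY : X + Y = P by rewrite -mulmxDl -plane_split.
have XP : X *m P = X by rewrite -mulmxA PP.
have PX : P *m X = X by rewrite /X !mulmxA PP.
have trX : \tr X = x by rewrite /X mxtrace_mulC !mulmxA PP mxtrace_mulC.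
have trY : \tr Y = y by rewrite /Y mxtrace_mulC !mulmxA PP mxtrace_mulC.
have xy : x + y = 2 by rewrite -trX -trY -mxtraceD XY.
have E : (1 - y) *: P = 0.
  have YE : Y = P - X by rewrite -XY addrC addKr.
  move: YY; rewrite YE mulmxBl !mulmxBr PP XP PX XX.
  have -> : y = 2 - x by rewrite -xy addrC addKr.
  rewrite !scalerBr !scalerBl opprB !scale1r !scaler_nat => /eqP.
  rewrite -subr_eq0 => /eqP <-.
  by apply/matrixP=> i j; rewrite !mxE; ring.
have y1 : y = 1.
  apply/eqP; rewrite eq_sym -subr_eq0; apply/eqP/mul2_eq0.
  by rewrite -trP mulrC -mxtraceZ E mxtrace0.
by split=> //; rewrite -[x](addrK y) xy y1; ring.
Qed.

(** Traces equal to 1 make M a and N b idempotent; expanding P M = M and P N = N then kills the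
    cross terms. So P is a sum of two orthogonal projectors. *)
Lemma plane_idem : [/\ M *m a *m M = M, N *m b *m N = N,
  M *m a *m N = 0 & N *m b *m M = 0].
Proof.
have [x1 y1] := plane_traces.
have MaM : M *m a *m M = M by rewrite mulmx_minors // x1 scale1r.
have NbN : N *m b *m N = N by rewrite mulmx_minors // y1 scale1r.
have PM : P *m M = M by rewrite mulmxA PP.
have PN : P *m N = N by rewrite mulmxA PP.
have E1 : M *m a *m N + N *m b *m N = N by rewrite -mulmxDl -plane_split PN.
have E2 : M *m a *m M + N *m b *m M = M by rewrite -mulmxDl -plane_split PM.
split=> //.
  by apply: (addIr (N *m b *m N)); rewrite E1 add0r NbN.
by apply: (addrI (M *m a *m M)); rewrite E2 addr0 MaM.
Qed.

End SplitPlane.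

(** * The spin module as an exterior algebra *)

Section Tree.
Variable A : comNzRingType.

(* [tree n] is the exterior algebra on n generators b_0, .., b_(n-1): the pair
   (x, y) stands for x + y b_(n-1). *)
Fixpoint tree (n : nat) : Type := if n is n'.+1 then (tree n' * tree n')%type
  else A.

Fixpoint tadd n : tree n -> tree n -> tree n :=
  if n is n'.+1 then fun t u => (tadd t.1 u.1, tadd t.2 u.2) else +%R.

Fixpoint tscale (a : A) n : tree n -> tree n :=
  if n is n'.+1 then fun t => (tscale a t.1, tscale a t.2) else *%R a.

Fixpoint tcst (a : A) n : tree n :=
  if n is n'.+1 then (tcst a n', tcst a n') else a.

(** [tvac a] and [ttop a] are the multiples by a of 1 and of b_0 ... b_(n-1); these model the two
    pure spinors. *)
Fixpoint tvac (a : A) n : tree n :=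
  if n is n'.+1 then (tvac a n', tcst 0 n') else a.

Fixpoint ttop (a : A) n : tree n :=
  if n is n'.+1 then (tcst 0 n', ttop a n') else a.

(** Bit j of the index tells whether b_j occurs in the monomial. *)
Fixpoint tree_of (f : nat -> A) n : tree n :=
  if n is n'.+1 then (tree_of f n', tree_of (fun i => f (i + 2 ^ n')%N) n')
  else f 0%N.

Lemma tree_of_scale (a : A) f n :
  tree_of (fun i => a * f i) n = tscale a (tree_of f n).
Proof. by elim: n f => //= n IH f; rewrite !IH. Qed.

Lemma tree_of_add f g n :
  tree_of (fun i => f i + g i) n = tadd (tree_of f n) (tree_of g n).
Proof. by elim: n f g => //= n IH f g; rewrite !IH. Qed.

Lemma tree_of_ext f g n : (forall i, (i < 2 ^ n)%N -> f i = g i) ->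
  tree_of f n = tree_of g n.
Proof.
elim: n f g => [|n IH] f g fg /=; first exact: fg.
have le2 : (2 ^ n <= 2 ^ n.+1)%N by rewrite leq_exp2l.
congr pair; apply: IH => i lt; apply: fg; first exact: leq_trans lt le2.
by rewrite expnS mul2n -addnn ltn_add2r.
Qed.

Lemma tree_of_inj f g n : tree_of f n = tree_of g n ->
  forall i, (i < 2 ^ n)%N -> f i = g i.
Proof.
elim: n f g => [|n IH] f g /=; first by move=> fg [].
move=> [fg1 fg2] i; have [lt _|le] := ltnP i (2 ^ n); first exact: IH fg1 i lt.
rewrite expnS mul2n -addnn -{1}(subnK le) ltn_add2r => lt.
by have := IH _ _ fg2 (i - 2 ^ n)%N lt; rewrite subnK.
Qed.

(* Right multiplication by the sum of al_i a_i + be_i b_i (i < n) and c e, where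
   a_i b_j + b_j a_i = delta_ij and e acts by 1 on the vacuum. *)
Fixpoint cliff_op (al be : nat -> A) (c : A) n : tree n -> tree n :=
  if n is n'.+1 then fun t =>
    (tadd (cliff_op al be c t.1) (tscale (al n') t.2),
     tadd (tscale (be n') t.1) (tscale (- 1) (cliff_op al be c t.2)))
  else *%R c.

Lemma cliff_op_ext al be al' be' c n (t : tree n) :
  (forall j, (j < n)%N -> al j = al' j) -> (forall j, (j < n)%N -> be j = be' j) ->
  cliff_op al be c t = cliff_op al' be' c t.
Proof.
elim: n t => //= n IH t alE beE.
rewrite alE // beE // !IH // => j jn; first [apply: alE | apply: beE]; exact: ltnW.
Qed.

Section Fock.
Variables (N m : nat) (X Y : nat -> 'M[A]_N) (E : 'M[A]_N) (eps : A) (s : 'rV[A]_N).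
Hypothesis XY : forall i j, (i < m)%N -> (j < m)%N ->
  X i *m Y j = (i == j)%:R%:M - Y j *m X i.
Hypothesis YY : forall i j, (i < m)%N -> (j < m)%N -> Y i *m Y j = - (Y j *m Y i).
Hypothesis Y0 : forall i, (i < m)%N -> Y i *m Y i = 0.
Hypothesis EY : forall i, (i < m)%N -> E *m Y i = - (Y i *m E).
Hypothesis sX : forall i, (i < m)%N -> s *m X i = 0.
Hypothesis sE : s *m E = eps *: s.

(** A monomial b_i ... b_j with increasing indices acts as s Y_i ... Y_j, on the vacuum s killed by
    all X_i. *)
Fixpoint fock n : tree n -> 'rV[A]_N :=
  if n is n'.+1 then fun t => fock t.1 + fock t.2 *m Y n' else fun a => a *: s.

Lemma fock_add n (t u : tree n) : fock (tadd t u) = fock t + fock u.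
Proof.
elim: n t u => [|n IH] t u /=; first by rewrite scalerDl.
by rewrite !IH mulmxDl addrACA.
Qed.

Lemma fock_scale a n (t : tree n) : fock (tscale a t) = a *: fock t.
Proof.
elim: n t => [|n IH] t /=; first by rewrite scalerA.
by rewrite !IH scalerDr scalemxAl.
Qed.

Lemma fock_cst0 n : fock (tcst 0 n) = 0.
Proof. by elim: n => [|n /= ->] /=; rewrite ?scale0r // mul0mx addr0. Qed.

Lemma fock_vac a n : fock (tvac a n) = a *: s.
Proof. by elim: n => [|n /= ->] //=; rewrite fock_cst0 mul0mx addr0. Qed.

Lemma fock_topS a n : fock (ttop a n.+1) = fock (ttop a n) *m Y n.
Proof. by rewrite /= fock_cst0 add0r. Qed.

Lemma fock_X n (t : tree n) i : (n <= i < m)%N -> fock t *m X i = 0.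
Proof.
elim: n t => [|n IH] t /andP[ni im] /=; first by rewrite -scalemxAl sX ?scaler0.
rewrite mulmxDl IH 1?ltnW //= add0r -mulmxA.
have -> : Y n *m X i = - (X i *m Y n).
  by rewrite XY ?(ltn_trans ni) // gtn_eqF // raddf0 sub0r opprK.
by rewrite mulmxN mulmxA IH 1?ltnW // mul0mx oppr0.
Qed.

Definition cliff_el (al be : nat -> A) c n : 'M[A]_N :=
  \sum_(i < n) (al i *: X i + be i *: Y i) + c *: E.

Lemma cliff_el_anti al be c n : (n < m)%N ->
  cliff_el al be c n *m Y n = - (Y n *m cliff_el al be c n).
Proof.
move=> nm; rewrite /cliff_el mulmxDl mulmxDr opprD -!(scalemxAl, scalemxAr) EY //.
rewrite scalerN; congr (_ - _); rewrite mulmx_suml mulmx_sumr -sumrN.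
apply: eq_bigr => i _; have im := ltn_trans (ltn_ord i) nm.
rewrite mulmxDl mulmxDr opprD -!(scalemxAl, scalemxAr) XY // YY // ltn_eqF //.
by rewrite raddf0 sub0r !scalerN.
Qed.

(** Only generators below n occur in x and y, so X_n kills both and y Y_n X_n = y; the rest of the
    vector anticommutes with Y_n, whence the sign in [cliff_op]. *)
Lemma fock_op al be c n (t : tree n) : (n <= m)%N ->
  fock (cliff_op al be (c * eps) t) = fock t *m cliff_el al be c n.
Proof.
elim: n t => [|n IH] t nm /=.
  rewrite /cliff_el big_ord0 add0r -scalemxAl -scalemxAr sE !scalerA.
  by congr (_ *: s); ring.
rewrite !fock_add !fock_scale !IH 1?ltnW //.
have -> : cliff_el al be c n.+1 =
    cliff_el al be c n + al n *: X n + be n *: Y n.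
  by rewrite /cliff_el big_ord_recr /= -!addrA; congr (_ + _);
    rewrite [RHS]addrC -addrA.
set V := cliff_el _ _ _ _; set x := fock t.1; set y := fock t.2.
have xX : x *m X n = 0 by rewrite fock_X // leqnn.
have yX : y *m X n = 0 by rewrite fock_X // leqnn.
have yYX : y *m Y n *m X n = y.
  have -> : y *m Y n *m X n = y *m (X n *m Y n + Y n *m X n) - y *m X n *m Y n.
    by rewrite mulmxDr !mulmxA addrC addKr.
  by rewrite yX mul0mx subr0 XY // eqxx subrK mulmx1.
have yYV : y *m Y n *m V = - (y *m V *m Y n).
  by rewrite -!mulmxA cliff_el_anti // mulmxN opprK.
have yYY : y *m Y n *m Y n = 0 by rewrite -mulmxA Y0 // mulmx0.
clearbody V x y.
have -> : (x + y *m Y n) *m (V + al n *: X n + be n *: Y n) =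
    x *m V + be n *: (x *m Y n) + (al n *: y - y *m V *m Y n).
  rewrite mulmxDl !mulmxDr -!scalemxAr xX yYX yYV yYY !scaler0 !addr0.
  by congr (_ + _); rewrite addrC.
rewrite mulmxDl -!scalemxAl scaleN1r -!addrA; congr (_ + _).
by rewrite addrCA.
Qed.

Lemma fock_YX n (t : tree n) : (n < m)%N -> fock t *m Y n *m X n = fock t.
Proof.
move=> nm; have -> : fock t *m Y n *m X n =
    fock t *m (X n *m Y n + Y n *m X n) - fock t *m X n *m Y n.
  by rewrite mulmxDr !mulmxA addrC addKr.
by rewrite fock_X ?leqnn // mul0mx subr0 XY // eqxx subrK mulmx1.
Qed.

(** Multiplication by X_n kills the first component and returns the second, so a tree is recovered
    from its top generator downwards. *)
Lemma fock_inj n : (n <= m)%N -> (forall a, a *: s = 0 -> a = 0) ->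
  injective (@fock n).
Proof.
move=> nm s0; elim: n nm => [|n IH] nm t u /=.
  by move=> /eqP; rewrite -subr_eq0 -scalerBl => /eqP/s0/eqP;
    rewrite subr_eq0 => /eqP.
move=> tu; have t2 : t.2 = u.2.
  apply: (IH (ltnW nm)); have := congr1 (mulmx^~ (X n)) tu.
  by rewrite !mulmxDl !fock_YX // !fock_X ?leqnn // !add0r.
have t1 : t.1 = u.1.
  by apply: (IH (ltnW nm)); apply: (addIr (fock t.2 *m Y n)); rewrite {2}t2.
by rewrite [t]surjective_pairing t1 t2 -surjective_pairing.
Qed.

Lemma fock_top_Y x n i : (n <= m)%N -> (i < n)%N -> fock (ttop x n) *m Y i = 0.
Proof.
elim: n i => // n IH i nm; rewrite ltnS leq_eqVlt fock_topS => /orP[/eqP ->|ni].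
  by rewrite -mulmxA Y0 // mulmx0.
rewrite -mulmxA YY // ?(ltn_trans ni) // mulmxN mulmxA.
by rewrite IH ?mul0mx ?oppr0 // ltnW.
Qed.

Lemma fock_killed_X n (t : tree n) : (n <= m)%N ->
  (forall i, (i < n)%N -> fock t *m X i = 0) -> exists a, fock t = a *: s.
Proof.
elim: n t => [|n IH] t nm /= tX; first by exists t.
have t2 : fock t.2 = 0.
  have := tX n (ltnSn n).
  by rewrite mulmxDl fock_YX // fock_X ?leqnn // add0r.
rewrite t2 mul0mx addr0; apply: IH (ltnW nm) _ => i ni.
by have := tX i (ltnW ni); rewrite t2 mul0mx addr0.
Qed.

Lemma fock_killed_Y n (t : tree n) : (n <= m)%N ->
  (forall i, (i < n)%N -> fock t *m Y i = 0) -> exists a, fock t = fock (ttop a n).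
Proof.
elim: n t => [|n IH] t nm tY; first by exists t.
have t1 : fock t.1 = 0.
  have := congr1 (mulmx^~ (X n)) (tY n (ltnSn n)).
  by rewrite /= mulmxDl -(mulmxA (fock t.2)) Y0 // mulmx0 addr0 fock_YX // mul0mx.
have [i ni|a ta] := IH t.2 (ltnW nm).
  have im := ltn_trans ni nm.
  have z1 : fock t.2 *m Y i *m Y n = 0.
    have := tY i (ltnW ni); rewrite /= t1 add0r -!mulmxA YY // mulmxN => /eqP.
    by rewrite oppr_eq0 => /eqP.
  have z2 : fock t.2 *m Y i *m X n = 0.
    have YX : Y i *m X n = - (X n *m Y i).
      by rewrite XY // gtn_eqF // raddf0 sub0r opprK.
    by rewrite -mulmxA YX mulmxN mulmxA fock_X ?leqnn // mul0mx oppr0.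
  (* Insert 1 = X_n Y_n + Y_n X_n; both terms vanish by [z1] and [z2]. *)
  rewrite -[LHS]mulmx1 -[1%:M](subrK (Y n *m X n)).
  rewrite -[1%:M]/(true%:R%:M) -[true](eqxx n) -XY // mulmxDr !mulmxA z1 z2.
  by rewrite !mul0mx addr0.
by exists a; rewrite fock_topS -ta /= t1 add0r.
Qed.

End Fock.
End Tree.

(** * The equations delta.u.v = 0 in exterior coordinates *)

Section PureSquare.
Variables (A : comNzRingType) (al be al' be' : nat -> A) (c c' d h : A).
Hypothesis hd : h * d = 1.

Ltac from H := apply: subr0_eq; first [rewrite -H; ring |
  rewrite -[RHS]oppr0 -H; ring].

(** Two Clifford factors move the vacuum to degrees 0, 1, 2 and the top form to degrees 3, 4, 5.
    Degrees 1 and 2 give the relations on [be], degrees 4 and 3 those on [al], the latter multiplied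
    by the invertible d. *)
Lemma pure_pair_equations :
  cliff_op al' be' c' (cliff_op al be c (tadd (tvac 1 5) (ttop d 5))) = tcst 0 5 ->
  forall i j, (i < 5)%N -> (j < 5)%N ->
  [/\ c * be' i = c' * be i, c * al' i = c' * al i,
      be i * be' j = be j * be' i & al i * al' j = al j * al' i].
Proof.
have d0 x y : d * x = d * y -> x = y.
  by move=> E; rewrite -[x]mul1r -[y]mul1r -hd -!mulrA E.
rewrite /=; case.
move=> h0 h1 h2 h3 h4 h5 h6 h7 h8 h9 h10 h11 h12 h13 h14 h15 h16 h17 h18 h19
  h20 h21 h22 h23 h24 h25 h26 h27 h28 h29 h30 h31.
(* The number of a hypothesis encodes its monomial in binary: singletons and pairs serve for [be],
   their complements in 31 for [al]. *)
have cb0 : c * be' 0 = c' * be 0 by from h1.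
have ca0 : c * al' 0 = c' * al 0 by apply: d0; from h30.
have cb1 : c * be' 1 = c' * be 1 by from h2.
have ca1 : c * al' 1 = c' * al 1 by apply: d0; from h29.
have cb2 : c * be' 2 = c' * be 2 by from h4.
have ca2 : c * al' 2 = c' * al 2 by apply: d0; from h27.
have cb3 : c * be' 3 = c' * be 3 by from h8.
have ca3 : c * al' 3 = c' * al 3 by apply: d0; from h23.
have cb4 : c * be' 4 = c' * be 4 by from h16.
have ca4 : c * al' 4 = c' * al 4 by apply: d0; from h15.
have b01 : be 0 * be' 1 = be 1 * be' 0 by from h3.
have a01 : al 0 * al' 1 = al 1 * al' 0 by apply: d0; from h28.
have b02 : be 0 * be' 2 = be 2 * be' 0 by from h5.
have a02 : al 0 * al' 2 = al 2 * al' 0 by apply: d0; from h26.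
have b03 : be 0 * be' 3 = be 3 * be' 0 by from h9.
have a03 : al 0 * al' 3 = al 3 * al' 0 by apply: d0; from h22.
have b04 : be 0 * be' 4 = be 4 * be' 0 by from h17.
have a04 : al 0 * al' 4 = al 4 * al' 0 by apply: d0; from h14.
have b12 : be 1 * be' 2 = be 2 * be' 1 by from h6.
have a12 : al 1 * al' 2 = al 2 * al' 1 by apply: d0; from h25.
have b13 : be 1 * be' 3 = be 3 * be' 1 by from h10.
have a13 : al 1 * al' 3 = al 3 * al' 1 by apply: d0; from h21.
have b14 : be 1 * be' 4 = be 4 * be' 1 by from h18.
have a14 : al 1 * al' 4 = al 4 * al' 1 by apply: d0; from h13.
have b23 : be 2 * be' 3 = be 3 * be' 2 by from h12.
have a23 : al 2 * al' 3 = al 3 * al' 2 by apply: d0; from h19.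
have b24 : be 2 * be' 4 = be 4 * be' 2 by from h20.
have a24 : al 2 * al' 4 = al 4 * al' 2 by apply: d0; from h11.
have b34 : be 3 * be' 4 = be 4 * be' 3 by from h24.
have a34 : al 3 * al' 4 = al 4 * al' 3 by apply: d0; from h7.
by move=> [|[|[|[|[|i]]]]] [|[|[|[|[|j]]]]] //.
Qed.
End PureSquare.

(** * Clifford relations over an algebra *)

Section CliffordBilinear.
Variables (k : fieldType) (n N : nat) (Q : 'M[k]_n) (gam : 'I_n -> 'M[k]_N).

Lemma cliff_is_linear (A : comNzRingType) (g : 'I_n -> 'M[A]_N) :
  linear (cliff g).
Proof.
move=> c u v; rewrite /cliff scaler_sumr -big_split; apply: eq_bigr => i _ /=.
by rewrite !mxE scalerDl scalerA.
Qed.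

HB.instance Definition _ (A : comNzRingType) (g : 'I_n -> 'M[A]_N) :=
  GRing.isLinear.Build A 'rV[A]_n 'M[A]_N _ (cliff g) (cliff_is_linear g).

Lemma cliff_mulmx (A : comNzRingType) (g : 'I_n -> 'M[A]_N) m (x : 'rV[A]_m)
    (M : 'M[A]_(m, n)) :
  cliff g (x *m M) = \sum_i x 0 i *: cliff g (row i M).
Proof. by rewrite mulmx_sum_row linear_sum; apply: eq_bigr => i _;
  rewrite linearZ. Qed.

Lemma cliff_coord (A : comNzRingType) (g : 'I_n -> 'M[A]_N) m
    (a b : 'M[A]_(m.+1, n)) (e : 'rV[A]_n) (x y : 'rV[A]_m.+1) (z : A) :
  cliff g (x *m a + y *m b + z *: e) =
  cliff_el (fun i => cliff g (row (inord i) a)) (fun i => cliff g (row (inord i) b))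
    (cliff g e) (fun i => x 0 (inord i)) (fun i => y 0 (inord i)) z m.+1.
Proof.
rewrite /cliff_el !linearD linearZ /= !cliff_mulmx big_split /=; congr (_ + _ + _).
  by apply: eq_bigr => i _; rewrite inord_val.
by apply: eq_bigr => i _; rewrite inord_val.
Qed.

Lemma map_cliff (A : comAlgType k) (v : 'rV[k]_n) :
  map_mx (in_alg A) (cliff gam v) = cliff (@gamA _ _ _ gam A) (map_mx (in_alg A) v).
Proof.
rewrite /cliff raddf_sum; apply: eq_bigr => i _ /=.
by rewrite map_mxZ mxE.
Qed.

Hypothesis polar : forall u v : 'rV[k]_n,
  cliff gam u *m cliff gam v + cliff gam v *m cliff gam u =
    (2 * (u *m Q *m v^T) 0 0)%:M.

Lemma cliff_polar (A : comAlgType k) (u v : 'rV[A]_n) :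
  cliff (@gamA _ _ _ gam A) u *m cliff (@gamA _ _ _ gam A) v +
  cliff (@gamA _ _ _ gam A) v *m cliff (@gamA _ _ _ gam A) u =
    (2 * (u *m map_mx (in_alg A) Q *m v^T) 0 0)%:M.
Proof.
set g := @gamA _ _ _ gam A.
have E i j : g i *m g j + g j *m g i = (2 * (Q i j)%:A)%:M.
  have := congr1 (map_mx (in_alg A)) (polar (delta_mx 0 i) (delta_mx 0 j)).
  have cE l : cliff gam (delta_mx 0 l) = gam l.
    rewrite /cliff (bigD1 l) //= mxE !eqxx scale1r big1 ?addr0 // => q ql.
    by rewrite mxE (negPf ql) andbF scale0r.
  rewrite !cE map_mxD !map_mxM map_scalar_mx => ->.
  rewrite -rowE trmx_delta -colE /= !mxE; congr (_%:M).
  by rewrite -[LHS]/(in_alg A _) rmorphM rmorph_nat.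
have -> : (u *m map_mx (in_alg A) Q *m v^T) 0 0 =
    \sum_i \sum_j u 0 i * v 0 j * (Q i j)%:A.
  rewrite mxE; under eq_bigr => j _ do rewrite !mxE mulr_suml.
  rewrite exchange_big; apply: eq_bigr => i _; apply: eq_bigr => j _.
  by rewrite !mxE mulrAC.
rewrite /cliff mulmx_suml mulmx_sumr mulr_sumr raddf_sum -big_split.
apply: eq_bigr => i _ /=; rewrite mulmx_sumr mulmx_suml mulr_sumr raddf_sum
  -big_split.
apply: eq_bigr => j _ /=.
rewrite -!(scalemxAl, scalemxAr) !scalerA [v 0 j * u 0 i]mulrC -scalerDr E.
by rewrite scale_scalar_mx; congr (_%:M); ring.
Qed.

End CliffordBilinear.

Lemma det_mx3 (A : comNzRingType) (M : 'M[A]_3) (i0 := 0 : 'I_3) (i1 := 1 : 'I_3)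
    (i2 := inord 2 : 'I_3) :
  \det M = M i0 i0 * (M i1 i1 * M i2 i2 - M i1 i2 * M i2 i1)
         - M i0 i1 * (M i1 i0 * M i2 i2 - M i1 i2 * M i2 i0)
         + M i0 i2 * (M i1 i0 * M i2 i1 - M i1 i1 * M i2 i0).
Proof.
have e2 : i2 = lift ord0 (lift ord0 ord0) by apply/val_inj; rewrite /= inordK.
have e1 : i1 = lift ord0 ord0 by apply/val_inj.
rewrite (expand_det_row _ ord0) !big_ord_recl big_ord0 /cofactor.
rewrite !(expand_det_row _ ord0) !big_ord_recl !big_ord0 /cofactor !det_mx11
  !mxE /=.
rewrite ?e2 ?e1 /i0.
have l1 : lift (lift ord0 ord0) ord0 = ord0 :> 'I_3 by apply/val_inj.
have l2 : lift (lift ord0 ord0) (lift ord0 ord0) = lift ord0 (lift ord0 ord0)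
  :> 'I_3 by apply/val_inj.
have l3 : lift (lift ord0 (lift ord0 ord0)) (ord0 :
  'I_2) = ord0 :> 'I_3 by apply/val_inj.
have l4 : lift (lift ord0 (lift ord0 ord0)) (lift ord0 ord0 :
  'I_2) = lift ord0 ord0 :> 'I_3 by apply/val_inj.
have l5 : lift (lift ord0 ord0) (ord0 : 'I_1) = ord0 :> 'I_2 by apply/val_inj.
rewrite ?l5 ?l1 ?l2 ?l3 ?l4 /=.
rewrite /bump /= !expr0 !expr1 !sqrrN ?expr1n.
have z1 : (0 : 'I_1) = ord0 by apply/val_inj.
have z3 : (0 : 'I_3) = ord0 by apply/val_inj.
by rewrite ?z1 z3; ring.
Qed.

Section Triple.
Variables (A : comNzRingType) (n N : nat) (g : 'I_n -> 'M[A]_N) (h6 : A).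
Hypothesis h6E : h6 * 6 = 1.

(* [c u * c v * c w] is alternating in [u, v, w], hence a combination of the
   3-minors of the matrix with rows [u, v, w]. *)
Lemma cliff_triple0 (u v w : 'rV[A]_n) :
  cliff g u *m cliff g v = - (cliff g v *m cliff g u) ->
  cliff g u *m cliff g w = - (cliff g w *m cliff g u) ->
  cliff g v *m cliff g w = - (cliff g w *m cliff g v) ->
  (forall i j l, u 0 i * (v 0 j * w 0 l - v 0 l * w 0 j)
     - u 0 j * (v 0 i * w 0 l - v 0 l * w 0 i)
     + u 0 l * (v 0 i * w 0 j - v 0 j * w 0 i) = 0) ->
  cliff g u *m cliff g v *m cliff g w = 0.
Proof.
move=> uv uw vw min0.
have cE x y z : cliff g x *m cliff g y *m cliff g z =
    \sum_i \sum_l \sum_j (x 0 i * y 0 j * z 0 l) *: (g i *m g j *m g l).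
  rewrite /cliff mulmx_suml mulmx_suml; apply: eq_bigr => i _.
  rewrite mulmx_sumr; apply: eq_bigr => l _.
  rewrite mulmx_sumr mulmx_suml; apply: eq_bigr => j _.
  by rewrite -!(scalemxAl, scalemxAr) !scalerA; congr (_ *: _); ring.
set U := cliff g u in uv uw *; set V := cliff g v in uv vw *;
  set W := cliff g w in uw vw *.
have E : 6 *: (U *m V *m W) = U *m V *m W - U *m W *m V - V *m U *m W
    + V *m W *m U + W *m U *m V - W *m V *m U.
  have e1 : U *m W *m V = - (U *m V *m W) by rewrite -!mulmxA vw mulmxN opprK.
  have e2 : V *m U *m W = - (U *m V *m W) by rewrite uv mulNmx opprK.
  have e3 : V *m W *m U = U *m V *m W.
    by rewrite uv mulNmx -!mulmxA uw mulmxN opprK.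
  have e4 : W *m U *m V = U *m V *m W.
    by rewrite -!mulmxA vw mulmxN !mulmxA uw mulNmx opprK.
  have e5 : W *m V *m U = - (U *m V *m W) by rewrite -e3 vw mulNmx opprK.
  rewrite e1 e2 e3 e4 e5 !opprK; apply/matrixP=> i j.
  by move: (U *m V *m W) => X; rewrite !mxE; ring.
suff E0 : 6 *: (U *m V *m W) = 0 by rewrite -[LHS]scale1r -h6E -scalerA E0 scaler0.
rewrite E !cE -!sumrN -!big_split big1 // => i _ /=.
rewrite -!sumrN -!big_split big1 // => l _ /=.
rewrite -!sumrN -!big_split big1 // => j _ /=.
rewrite -!scaleNr -!scalerDl; apply: (etrans _ (scale0r _)); congr (_ *: _).
by rewrite -[RHS](min0 i j l); ring.
Qed.

End Triple.

Section CliffordRelations.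
Variables (k : fieldType) (n N : nat) (Q : 'M[k]_n) (gam : 'I_n -> 'M[k]_N).
Hypothesis k0 : [pchar k] =i pred0.
Hypothesis polar : forall u v : 'rV[k]_n,
  cliff gam u *m cliff gam v + cliff gam v *m cliff gam u =
    (2 * (u *m Q *m v^T) 0 0)%:M.
Variables (m : nat) (a b : 'M[k]_(m.+1, n)) (e : 'rV[k]_n).
Hypotheses (bQb : b *m Q *m b^T = 0) (aQb : a *m Q *m b^T = (2^-1)%:M).
Hypothesis eQb : e *m Q *m b^T = 0.

Definition cliff_row (V : 'M[k]_(m.+1, n)) (i : nat) := cliff gam (row (inord i) V).

Lemma row_form p q (U : 'M[k]_(p, n)) (V : 'M[k]_(q, n)) i j :
  (row i U *m Q *m (row j V)^T) 0 0 = (U *m Q *m V^T) i j.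
Proof. by rewrite -row_mul !mxE; apply: eq_bigr => l _; rewrite !mxE. Qed.

Lemma inord_eq i j : (i <= m)%N -> (j <= m)%N ->
  (inord i == inord j :> 'I_m.+1) = (i == j).
Proof. by move=> im jm; rewrite -val_eqE /= !inordK. Qed.

(** The pairing 1/2 cancels the 2 of the polarised relation, which leaves the canonical
    anticommutation relations. *)
Lemma cliff_row_ab i j : (i <= m)%N -> (j <= m)%N ->
  cliff_row a i *m cliff_row b j = (i == j)%:R%:M - cliff_row b j *m cliff_row a i.
Proof.
have /pcharf0P k0' := k0.
move=> im jm; apply: (addIr (cliff_row b j *m cliff_row a i)); rewrite subrK.
rewrite polar row_form aQb mxE inord_eq //; case: eqP => _.
  by rewrite mulr1n mulfV ?k0'.
by rewrite mulr0n mulr0.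
Qed.

Lemma cliff_row_bb i j : (i <= m)%N -> (j <= m)%N ->
  cliff_row b i *m cliff_row b j = - (cliff_row b j *m cliff_row b i).
Proof.
move=> im jm; apply: (addIr (cliff_row b j *m cliff_row b i)); rewrite addNr.
by rewrite polar row_form bQb mxE mulr0 raddf0.
Qed.

Lemma cliff_row_b2 i : (i <= m)%N -> cliff_row b i *m cliff_row b i = 0.
Proof.
have /pcharf0P k0' := k0.
move=> im; have /eqP := cliff_row_bb im im; rewrite -addr_eq0 -mulr2n -scaler_nat.
by rewrite scaler_eq0 k0' /= => /eqP.
Qed.

Lemma cliff_row_eb i : (i <= m)%N ->
  cliff gam e *m cliff_row b i = - (cliff_row b i *m cliff gam e).
Proof.
move=> im; apply: (addIr (cliff_row b i *m cliff gam e)); rewrite addNr.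
by rewrite -[e](row_id 0) polar row_form eQb mxE mulr0 raddf0.
Qed.

End CliffordRelations.

(** * The zero locus of a sum of two pure spinors *)

Section Core.
Variables (k : fieldType) (n N : nat) (Q : 'M[k]_n) (gam : 'I_n -> 'M[k]_N).
Hypothesis k0 : [pchar k] =i pred0.
Hypothesis Qsym : Q^T = Q.
Hypothesis polar : forall u v : 'rV[k]_n,
  cliff gam u *m cliff gam v + cliff gam v *m cliff gam u =
    (2 * (u *m Q *m v^T) 0 0)%:M.
Variables (a b : 'M[k]_(5, n)) (e : 'rV[k]_n).
Variables (Sa Sb : 'M[k]_(n, 5)) (Sc : 'M[k]_(n, 1)).
Hypotheses (aSa : a *m Sa = 1%:M) (bSb : b *m Sb = 1%:M).
Hypotheses (aSb : a *m Sb = 0) (bSa : b *m Sa = 0).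
Hypothesis S1 : Sa *m a + Sb *m b + Sc *m e = 1%:M.
Hypotheses (aQa : a *m Q *m a^T = 0) (bQb : b *m Q *m b^T = 0).
Hypotheses (aQb : a *m Q *m b^T = (2^-1)%:M).
Hypothesis eQb : e *m Q *m b^T = 0.
Variables (s : 'rV[k]_N) (d : k).
Hypotheses (s_neq0 : s != 0) (d_neq0 : d != 0).
Hypothesis sa : forall i, s *m cliff gam (row i a) = 0.
Hypothesis se : s *m cliff gam e = s.

Section Points.
Variable A : comAlgType k.
Local Notation "M ^A" := (map_mx (in_alg A) M) (at level 8, format "M ^A").
Local Notation cl := (cliff (@gamA _ _ _ gam A)).

Definition cliff_a (i : nat) := cl (row (inord i) a^A).
Definition cliff_b (i : nat) := cl (row (inord i) b^A).

Lemma in_alg_half : 2 * in_alg A 2^-1 = 1.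
Proof.
have /pcharf0P k0' := k0.
by rewrite -(rmorph_nat (in_alg A)) -rmorphM mulfV ?rmorph1 // k0'.
Qed.

Lemma map_cliff_row (V : 'M[k]_(5, n)) i :
  cl (row (inord i) V^A) = (cliff_row gam V i)^A.
Proof. by rewrite -map_row -map_cliff. Qed.

Lemma cliff_abA i j : (i < 5)%N -> (j < 5)%N ->
  cliff_a i *m cliff_b j = (i == j)%:R%:M - cliff_b j *m cliff_a i.
Proof.
move=> i5 j5; rewrite /cliff_a /cliff_b !map_cliff_row -!map_mxM (cliff_row_ab
  k0 polar aQb) //.
by rewrite map_mxB map_scalar_mx rmorph_nat.
Qed.

Lemma cliff_bbA i j : (i < 5)%N -> (j < 5)%N ->
  cliff_b i *m cliff_b j = - (cliff_b j *m cliff_b i).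
Proof.
move=> i5 j5; rewrite /cliff_b !map_cliff_row -!map_mxM (cliff_row_bb polar bQb) //.
by rewrite map_mxN.
Qed.

Lemma cliff_b2A i : (i < 5)%N -> cliff_b i *m cliff_b i = 0.
Proof.
move=> i5; rewrite /cliff_b !map_cliff_row -!map_mxM (cliff_row_b2 k0 polar bQb) //.
exact: map_mx0.
Qed.

Lemma cliff_ebA i : (i < 5)%N -> cl e^A *m cliff_b i = - (cliff_b i *m cl e^A).
Proof.
move=> i5; rewrite /cliff_b map_cliff_row -map_cliff -!map_mxM (cliff_row_eb
  polar eQb) //.
by rewrite map_mxN.
Qed.

Lemma s_cliff_a i : (i < 5)%N -> s^A *m cliff_a i = 0.
Proof. by move=> i5; rewrite /cliff_a -map_row -map_cliff -map_mxM sa map_mx0. Qed.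

Lemma s_cliff_e : s^A *m cl e^A = 1 *: s^A.
Proof. by rewrite -map_cliff -map_mxM se scale1r. Qed.

Lemma sA_free (x : A) : x *: s^A = 0 -> x = 0.
Proof.
have /rV0Pn [i si] := s_neq0.
move=> /rowP /(_ i); rewrite !mxE => E.
by rewrite -[x]mulr1 -(rmorph1 (in_alg A)) -(mulfV si) rmorphM mulrA E mul0r.
Qed.

Lemma fock_cl (x y : 'rV[A]_5) (z : A) (t : tree A 5) :
  fock cliff_b s^A t *m cl (x *m a^A + y *m b^A + z *: e^A) =
  fock cliff_b s^A (cliff_op (fun i => x 0 (inord i)) (fun i => y 0 (inord i)) z t).
Proof.
rewrite cliff_coord; have := fock_op cliff_abA cliff_bbA cliff_b2A cliff_ebA
  s_cliff_a s_cliff_e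
  (fun i => x 0 (inord i)) (fun i => y 0 (inord i)) z t (leqnn 5).
by rewrite mulr1.
Qed.

Lemma map_top :
  (s + fock (cliff_row gam b) s (ttop d 5))^A =
  fock cliff_b s^A (tadd (tvac 1 5) (ttop (in_alg A d) 5)).
Proof.
rewrite fock_add fock_vac scale1r map_mxD; congr (_ + _).
elim: 5%N => [|n' IH]; first by rewrite /= map_mxZ.
by rewrite !fock_topS map_mxM IH /cliff_b map_cliff_row.
Qed.

Let delta : 'rV[k]_N := s + fock (cliff_row gam b) s (ttop d 5).

Lemma quad_ab (x y : 'rV[A]_5) :
  quad Q^A (x *m a^A + y *m b^A) = (x *m y^T) 0 0.
Proof.
have T1 (F : 'M[A]_1) : F^T = F by apply/matrixP=> i j; rewrite mxE !ord1.
have xx : x *m a^A *m Q^A *m (x *m a^A)^T = 0.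
  by rewrite trmx_mul map_trmx mulmxA -!(mulmxA x) -!map_mxM aQa map_mx0 mul0mx
    mulmx0.
have yy : y *m b^A *m Q^A *m (y *m b^A)^T = 0.
  by rewrite trmx_mul map_trmx mulmxA -!(mulmxA y) -!map_mxM bQb map_mx0 mul0mx
    mulmx0.
have xy : x *m a^A *m Q^A *m (y *m b^A)^T = in_alg A 2^-1 *: (x *m y^T).
  rewrite trmx_mul map_trmx mulmxA -!(mulmxA x) -!map_mxM aQb.
  by rewrite map_scalar_mx mul_scalar_mx -scalemxAr.
have yx : y *m b^A *m Q^A *m (x *m a^A)^T = in_alg A 2^-1 *: (x *m y^T).
  by rewrite -xy -[LHS]T1 !trmx_mul !trmxK map_trmx Qsym !mulmxA.
rewrite /quad linearD /= !mulmxDl !mulmxDr xx yy xy yx add0r addr0 -scalerDl.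
by rewrite (_ : _ + _ = 1) ?scale1r // -in_alg_half mulr_natl mulr2n.
Qed.

Section Forward.
Variable U : set 'rV[A]_n.
Hypothesis ptsU : spinor_zero_pts Q gam delta U.
Variable P : 'M[A]_n.
Hypotheses (PP : P *m P = P) (UE : U = rowspace P).
Hypothesis rP : forall (K : fieldType) (f : {rmorphism A -> K}),
  \rank (map_mx f P) = 2.

Lemma U_mulP x : U (x *m P).
Proof. by rewrite UE; exists x. Qed.

Lemma mulmxP_U u : U u -> u *m P = u.
Proof. by rewrite UE => -[x _ <-]; rewrite -mulmxA PP. Qed.

Lemma U_iso u : U u -> quad Q^A u = 0.
Proof. by case: ptsU => -[_ iso] _; apply: iso. Qed.

Lemma U_form u v : U u -> U v -> 2 * (u *m Q^A *m v^T) 0 0 = 0.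
Proof.
move=> Uu Uv; have Uuv : U (u + v) by rewrite -(mulmxP_U Uu) -(mulmxP_U Uv)
  -mulmxDl; apply: U_mulP.
have := U_iso Uuv; have := U_iso Uu; have := U_iso Uv.
have DE (F G : 'M[A]_1) : (F + G) 0 0 = F 0 0 + G 0 0 by rewrite mxE.
have vu : v *m Q^A *m u^T = u *m Q^A *m v^T.
  have T1 (F : 'M[A]_1) : F^T = F by apply/matrixP=> i j; rewrite mxE !ord1.
  by rewrite -[LHS]T1 !trmx_mul !trmxK map_trmx Qsym mulmxA.
rewrite /quad linearD /= !mulmxDl !mulmxDr !DE vu => -> ->.
by rewrite add0r addr0 mulr_natl mulr2n.
Qed.

Lemma U_anti u v : U u -> U v -> cl u *m cl v = - (cl v *m cl u).
Proof.
move=> Uu Uv; apply: (addIr (cl v *m cl u)).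
by rewrite addNr (cliff_polar polar) U_form // raddf0.
Qed.

(** Three vectors fixed by a projector of rank 2 have vanishing 3-minors; [D] stacks the vectors and
    [C] selects the columns i, j, l. *)
Lemma U_triple u v w : U u -> U v -> U w -> cl u *m cl v *m cl w = 0.
Proof.
move=> Uu Uv Uw; have [h6 h6E] := natr_unit A k0 (isT : (0 < 6)%N).
apply: (cliff_triple0 (h6 := h6)); rewrite 1?mulrC //; try exact: U_anti.
move=> i j l.
pose D : 'M[A]_(3, n) := \matrix_(q < 3) nth u [:: u; v; w] q.
pose C : 'M[A]_(n, 3) := \matrix_(p < n, q < 3) (p == nth i [:: i; j; l] q)%:R.
have := minor_constant_rank k0 PP rP C D isT; rewrite det_mx3.
have DP : D *m P = D.
  apply/row_matrixP=> q; rewrite row_mul rowK.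
  by case: q => -[|[|[|q]]] //= _; rewrite mulmxP_U.
have DC p q : (D *m C) p q = D p (nth i [:: i; j; l] q).
  rewrite mxE (bigD1 (nth i [:: i; j; l] q)) //= [C _ _]mxE eqxx mulr1 big1
    ?addr0 // => t tq.
  by rewrite [C _ _]mxE (negPf tq) mulr0.
by rewrite DP !DC !mxE /= inordK.
Qed.

(** By hypothesis delta is a combination of spinors x.w with w in U, and w.u.v = 0. *)
Lemma delta_cliff_cliff u v : U u -> U v -> delta^A *m cl u *m cl v = 0.
Proof.
move=> Uu Uv; case: ptsU => _.
apply: (span_min (W := [set x | x *m cl u *m cl v = 0]%classic)).
  split=> [|c x y /= x0 y0]; first by rewrite /= !mul0mx.
  by rewrite !mulmxDl -!scalemxAl x0 y0 scaler0 addr0.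
move=> _ [w Uw [x _ <-]] /=.
by rewrite -!mulmxA (mulmxA (cl w)) U_triple // mulmx0.
Qed.

Lemma coordA u : u = (u *m Sa^A) *m a^A + (u *m Sb^A) *m b^A + (u *m Sc^A) 0 0
  *: e^A.
Proof.
rewrite -mul_scalar_mx -mx11_scalar -!mulmxA -!mulmxDr -!map_mxM -!map_mxD S1.
by rewrite map_mx1 mulmx1.
Qed.

Lemma U_equations u v (i j : 'I_5) : U u -> U v ->
  [/\ (u *m Sc^A) 0 0 * (v *m Sb^A) 0 i = (v *m Sc^A) 0 0 * (u *m Sb^A) 0 i,
      (u *m Sc^A) 0 0 * (v *m Sa^A) 0 i = (v *m Sc^A) 0 0 * (u *m Sa^A) 0 i,
      (u *m Sb^A) 0 i * (v *m Sb^A) 0 j = (u *m Sb^A) 0 j * (v *m Sb^A) 0 i &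
      (u *m Sa^A) 0 i * (v *m Sa^A) 0 j = (u *m Sa^A) 0 j * (v *m Sa^A) 0 i].
Proof.
move=> Uu Uv; have := delta_cliff_cliff Uu Uv.
rewrite (coordA u) (coordA v) map_top !fock_cl -(coordA u) -(coordA v).
rewrite -(fock_cst0 cliff_b s^A 5).
move/(fock_inj cliff_abA s_cliff_a (leqnn 5) sA_free).
have hd : in_alg A d^-1 * in_alg A d = 1 by rewrite -rmorphM mulVf ?rmorph1.
move/(pure_pair_equations hd)/(_ i j (ltn_ord i) (ltn_ord j)).
by rewrite !inord_val.
Qed.

Local Notation M := (P *m Sa^A).
Local Notation N' := (P *m Sb^A).

Lemma U_row i : U (row i P).
Proof. by rewrite UE; apply: row_rowspace. Qed.

Lemma isotropic_plane_split : [/\ P = M *m a^A + N' *m b^A,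
  [/\ M *m a^A *m M = M, N' *m b^A *m N' = N', M *m a^A *m N' = 0 & N' *m b^A
    *m M = 0],
  \tr (a^A *m M) = 1 /\ \tr (b^A *m N') = 1 & M *m N'^T = 0].
Proof.
have E i j l l' : [/\ (P *m Sc^A) i 0 * N' j l = (P *m Sc^A) j 0 * N' i l,
    (P *m Sc^A) i 0 * M j l = (P *m Sc^A) j 0 * M i l,
    N' i l * N' j l' = N' i l' * N' j l & M i l * M j l' = M i l' * M j l].
  by have := U_equations l l' (U_row i) (U_row j); rewrite -!row_mul !mxE.
have cM i j l : (P *m Sc^A) i 0 * M j l = (P *m Sc^A) j 0 * M i l by have [] :=
  E i j l l.
have cN i j l : (P *m Sc^A) i 0 * N' j l = (P *m Sc^A) j 0 * N' i l by have []
  := E i j l l.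
have mM i j l l' : M i l * M j l' = M i l' * M j l by have [] := E i j l l'.
have mN i j l l' : N' i l * N' j l' = N' i l' * N' j l by have [] := E i j l l'.
have trP : \tr P = 2 by apply: mxtrace_constant_rank k0 PP rP.
have S1A : Sa^A *m a^A + Sb^A *m b^A + Sc^A *m e^A = 1%:M.
  by rewrite -!map_mxM -!map_mxD S1 map_mx1.
have half : in_alg A 2^-1 * 2 = 1 by rewrite mulrC in_alg_half.
have PE := plane_split S1A PP trP cM cN.
have idem := plane_idem S1A half PP trP cM cN mM mN.
have tr1 := plane_traces S1A half PP trP cM cN mM mN.
split=> //; case: idem => MaM NbN MaN NbM.
apply/matrixP=> i j; rewrite [RHS]mxE.
pose x := delta_mx 0 i : 'rV[A]_n; pose y := delta_mx 0 j : 'rV[A]_n.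
have MaP : M *m a^A *m P = M *m a^A.
  by rewrite [Z in _ *m Z = _]PE mulmxDr (mulmxA _ M) (mulmxA _ N') MaM MaN
    mul0mx addr0.
have NbP : N' *m b^A *m P = N' *m b^A.
  by rewrite [Z in _ *m Z = _]PE mulmxDr (mulmxA _ M) (mulmxA _ N') NbN NbM
    mul0mx add0r.
(* Both M a and N' b are fixed by P, so row i of the first plus row j of the second lies in U. Its
   quadratic form is the (i, j) entry of M N'^T. *)
have Uu : U (x *m M *m a^A + y *m N' *m b^A).
  rewrite -[x *m M *m _]mulmxA -[y *m N' *m _]mulmxA -MaP -NbP !(mulmxA _ _ P).
  by rewrite -mulmxDl; apply: U_mulP.
apply: etrans (U_iso Uu); rewrite quad_ab (trmx_mul y) (mulmxA (x *m M))
  -(mulmxA x M).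
by rewrite -rowE trmx_delta -colE [RHS]mxE [RHS]mxE.
Qed.

End Forward.
(** Over a field of characteristic zero an idempotent has rank equal to its trace, and traces
    commute with base change. Rank conditions thus reduce to traces over A. *)
Lemma rank_of_mxtrace q m (p : 'M[A]_q) : p *m p = p -> \tr p = m%:R ->
  forall (K : fieldType) (f : {rmorphism A -> K}), \rank (map_mx f p) = m.
Proof.
move=> pp trp K f; have fpp : map_mx f p *m map_mx f p = map_mx f p by rewrite
  -map_mxM pp.
apply: (natr_inj (pchar_point k0 f)).
by rewrite /= -mxtrace_idempotent // trace_map_mx trp rmorph_nat.
Qed.

(* The hyperplane is the orthogonal of the projection of U to <b>, which is
   identified with the dual of <a>. *)
Definition flag_of (U : set 'rV[A]_n) : set 'rV[A]_5 * set 'rV[A]_5 :=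
  ([set u *m Sa^A | u in U],
   [set x | forall u, U u -> x *m (u *m Sb^A)^T = 0])%classic.

Definition plane_of (LH : set 'rV[A]_5 * set 'rV[A]_5) : set 'rV[A]_n :=
  [set v | exists x y, [/\ LH.1 x, forall z, LH.2 z -> z *m y^T = 0 &
                          v = x *m a^A + y *m b^A]]%classic.

(** The set-theoretic description of the flag is not visibly stable under base change; these
    explicit matrices are. *)
Lemma flag_of_rowspace (U : set 'rV[A]_n) (P : 'M[A]_n) :
  spinor_zero_pts Q gam delta U -> P *m P = P -> U = rowspace P ->
  (forall (K : fieldType) (f : {rmorphism A -> K}), \rank (map_mx f P) = 2) ->
  flag_of U = (rowspace (a^A *m P *m Sa^A), rowspace (1%:M - (b^A *m P *m Sb^A)^T)).
Proof.
move=> ptsU PP UE rP; have [PE [MaM NbN MaN NbM] _ MN] := isotropic_plane_split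
  ptsU PP UE rP.
have Mp : P *m Sa^A *m (a^A *m P *m Sa^A) = P *m Sa^A.
  by rewrite -(mulmxA a^A) (mulmxA _ a^A).
have Nq : P *m Sb^A *m (b^A *m P *m Sb^A) = P *m Sb^A.
  by rewrite -(mulmxA b^A) (mulmxA _ b^A).
rewrite /flag_of UE; congr pair; apply/seteqP; split.
- move=> _ [_ [x _ <-] <-]; exists (x *m (P *m Sa^A)) => //.
  by rewrite -mulmxA Mp mulmxA.
- move=> _ [x _ <-]; exists (x *m a^A *m P); first by exists (x *m a^A).
  by rewrite !mulmxA.
- move=> x /= xU; exists x => //.
  have xN : x *m (P *m Sb^A)^T = 0.
    apply: trmx_inj; apply/row_matrixP=> i; rewrite trmx0 row0 trmx_mul trmxK.
    have := xU (row i P) (row_rowspace P i).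
    by move/(congr1 trmx); rewrite trmx_mul trmxK trmx0 -row_mul -row_mul.
  rewrite mulmxBr mulmx1 -[b^A *m P *m _]mulmxA (trmx_mul b^A) mulmxA xN mul0mx.
  by rewrite subr0.
- move=> _ [x _ <-] _ [y _ <-] /=.
  have qN : (1%:M - (b^A *m P *m Sb^A)^T) *m (P *m Sb^A)^T = 0.
    by rewrite mulmxBl mul1mx -trmx_mul Nq subrr.
  by rewrite -(mulmxA y) (trmx_mul y) mulmxA -(mulmxA x) qN mulmx0 mul0mx.
Qed.

Lemma flag_of_pts (U : set 'rV[A]_n) :
  spinor_zero_pts Q gam delta U -> Fl_pts (flag_of U).
Proof.
move=> ptsU; have [[[P [PP UE rP]] _] _] := ptsU.
have [PE [MaM NbN MaN NbM] [tra trb] MN] := isotropic_plane_split ptsU PP UE rP.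
rewrite (flag_of_rowspace ptsU PP UE rP).
set p := a^A *m P *m Sa^A; set q := b^A *m P *m Sb^A.
have pp : p *m p = p.
  by rewrite /p -[in RHS](mulmxA a^A) -[in RHS]MaM !mulmxA.
have qq : q *m q = q.
  by rewrite /q -[in RHS](mulmxA b^A) -[in RHS]NbN !mulmxA.
have qqT : (1%:M - q^T) *m (1%:M - q^T) = 1%:M - q^T.
  by rewrite mulmxBr mulmx1 mulmxBl mul1mx -trmx_mul qq subrr subr0.
split=> /=.
- by exists p; split=> //; apply: rank_of_mxtrace; rewrite // /p -mulmxA.
- exists (1%:M - q^T); split=> //; apply: rank_of_mxtrace => //.
  rewrite raddfB /= mxtrace_tr mxtrace1 /q -mulmxA trb.
  by rewrite -[1 in LHS]/(1%:R) -natrB.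
- move=> _ [x _ <-]; exists (x *m p) => //.
  (* This is a (M N'^T) b^T, zero by isotropy; it gives p (1 - q^T) = p, that is, the line lies in
     the hyperplane. *)
  have pq : p *m q^T = 0.
    rewrite /p /q -!(mulmxA _ P) (trmx_mul b^A) (mulmxA (a^A *m _)) -(mulmxA
      a^A) MN.
    by rewrite mulmx0 mul0mx.
  by rewrite mulmxBr mulmx1 -mulmxA pq mulmx0 subr0.
Qed.

Lemma flag_ofK (U : set 'rV[A]_n) :
  spinor_zero_pts Q gam delta U -> plane_of (flag_of U) = U.
Proof.
move=> ptsU; have [[[P [PP UE rP]] _] _] := ptsU.
have [PE [MaM NbN MaN NbM] [tra trb] MN] := isotropic_plane_split ptsU PP UE rP.
have MaP : P *m Sa^A *m a^A *m P = P *m Sa^A *m a^A.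
  rewrite [Z in _ *m Z = _]PE mulmxDr (mulmxA _ (P *m _)) (mulmxA _ (P *m _)).
  by rewrite MaM MaN mul0mx addr0.
have NbP : P *m Sb^A *m b^A *m P = P *m Sb^A *m b^A.
  rewrite [Z in _ *m Z = _]PE mulmxDr (mulmxA _ (P *m _)) (mulmxA _ (P *m _)).
  by rewrite NbN NbM mul0mx add0r.
rewrite (flag_of_rowspace ptsU PP UE rP); apply/seteqP; split.
- move=> _ [_ [y [/= [x _ <-] Hy ->]]].
  set q := b^A *m P *m Sb^A in Hy.
  have yq : y = y *m q.
    apply/eqP; rewrite -subr_eq0 -{1}[y]mulmx1 -mulmxBr; apply/eqP.
    apply: trmx_inj; apply/row_matrixP=> i; rewrite trmx0 row0 trmx_mul row_mul.
    have := Hy (row i (1%:M - q^T)) (row_rowspace _ i).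
    by rewrite [(1%:M - q)^T]raddfB /= trmx1.
  have -> : x *m (a^A *m P *m Sa^A) *m a^A + y *m b^A =
      (x *m a^A) *m (P *m Sa^A *m a^A) + (y *m b^A) *m (P *m Sb^A *m b^A).
    by rewrite {1}yq /q !mulmxA.
  by rewrite UE -MaP -NbP !(mulmxA _ _ P) -mulmxDl; eexists.
- rewrite UE => _ [x _ <-] /=.
  exists (x *m P *m Sa^A), (x *m P *m Sb^A); split.
  + have Mp : P *m Sa^A *m (a^A *m P *m Sa^A) = P *m Sa^A.
      by rewrite -(mulmxA a^A) (mulmxA _ a^A).
    by exists (x *m P *m Sa^A) => //; rewrite -(mulmxA x) -mulmxA Mp.
  + move=> _ [z _ <-].
    have Nq : P *m Sb^A *m (b^A *m P *m Sb^A) = P *m Sb^A.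
      by rewrite -(mulmxA b^A) (mulmxA _ b^A).
    have qN : (1%:M - (b^A *m P *m Sb^A)^T) *m (P *m Sb^A)^T = 0.
      by rewrite mulmxBl mul1mx -trmx_mul Nq subrr.
    by rewrite -(mulmxA x) (trmx_mul x) mulmxA -(mulmxA z) qN mulmx0 mul0mx.
  + by rewrite {1}PE mulmxDr !mulmxA.
Qed.

(** Summing t.Z_j.(p V)_j over j gives tr(p) t = t, with every term in the image of U: no generator
    of the row space of p is needed. *)
Lemma cliff_image_trace (U : set 'rV[A]_n) (p : 'M[A]_5) (t : 'rV[A]_N)
    (V : 'M[k]_(5, n)) (Z : 'I_5 -> 'M[A]_N) :
  (forall j, U (row j (p *m V^A))) -> \tr p = 1 ->
  (forall j l, t *m Z j *m cl (row l V^A) = (j == l)%:R *: t) ->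
  cliff_image gam U t.
Proof.
move=> Up trp tZ.
have -> : t = \sum_j 1 *: (t *m Z j *m cl (row j (p *m V^A))).
  rewrite -[LHS]scale1r -{1}trp scaler_suml; apply: eq_bigr => j _.
  rewrite row_mul cliff_mulmx mulmx_sumr (bigD1 j) //= -scalemxAr tZ eqxx !scale1r.
  rewrite mxE big1 ?addr0 // => l lj.
  by rewrite -scalemxAr tZ eq_sym (negPf lj) scale0r scaler0.
apply: (submodule_sum (W := cliff_image gam U)); first exact: span_submodule.
by move=> j; apply: Defs.sub_span; exists (row j (p *m V^A));
  [exact: Up|exists (t *m Z j)].
Qed.

Section Backward.
Variable LH : set 'rV[A]_5 * set 'rV[A]_5.
Hypothesis ptsLH : Fl_pts LH.
Variables p h : 'M[A]_5.
Hypotheses (pp : p *m p = p) (hh : h *m h = h).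
Hypotheses (LE : LH.1 = rowspace p) (HE : LH.2 = rowspace h).
Hypotheses (trp : \tr p = 1) (trh : \tr h = 4).
(** [q] projects onto the orthogonal of H, and [P] onto the plane L + M. *)
Let q : 'M[A]_5 := (1%:M - h)^T.
Let P : 'M[A]_n := Sa^A *m p *m a^A + Sb^A *m q *m b^A.

Lemma hqT : h *m q^T = 0.
Proof. by rewrite /q trmxK mulmxBr mulmx1 hh subrr. Qed.

Lemma q_idem : q *m q = q.
Proof.
rewrite /q -trmx_mul; congr trmx.
by rewrite mulmxBr mulmx1 mulmxBl mul1mx hh subrr subr0.
Qed.

Lemma mxtrace_q : \tr q = 1.
Proof. by rewrite /q mxtrace_tr raddfB /= mxtrace1 trh -natrB. Qed.

Lemma plane_mxE (x y : 'rV[A]_5) :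
  (x *m a^A + y *m b^A) *m P = x *m p *m a^A + y *m q *m b^A.
Proof.
have A1 : a^A *m Sa^A = 1%:M by rewrite -map_mxM aSa map_mx1.
have A2 : a^A *m Sb^A = 0 by rewrite -map_mxM aSb map_mx0.
have A3 : b^A *m Sa^A = 0 by rewrite -map_mxM bSa map_mx0.
have A4 : b^A *m Sb^A = 1%:M by rewrite -map_mxM bSb map_mx1.
rewrite mulmxDl !mulmxDr -!(mulmxA x) -!(mulmxA y) !(mulmxA a^A) !(mulmxA b^A).
by rewrite A1 A2 A3 A4 !mul0mx !mulmx0 !mul1mx addr0 add0r.
Qed.

Lemma plane_of_rowspace : plane_of LH = rowspace P.
Proof.
apply/seteqP; split.
- move=> _ [x [y [Lx Hy ->]]].
  have xp : x *m p = x by move: Lx; rewrite LE => -[w _ <-]; rewrite -mulmxA pp.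
  have yq : y *m q = y.
    have hy : h *m y^T = 0.
      apply/row_matrixP=> i; rewrite row0 row_mul; apply: Hy.
      by rewrite HE; apply: row_rowspace.
    by apply: trmx_inj; rewrite trmx_mul /q trmxK mulmxBl mul1mx hy subr0.
  by exists (x *m a^A + y *m b^A) => //; rewrite plane_mxE xp yq.
- move=> _ [w _ <-]; exists (w *m Sa^A *m p), (w *m Sb^A *m q); split.
  + by rewrite LE; exists (w *m Sa^A).
  + move=> z'; rewrite HE => -[z _ <-].
    by rewrite (trmx_mul _ q) !mulmxA -(mulmxA z) hqT mulmx0 mul0mx.
  + by rewrite mulmxDr !mulmxA.
Qed.

Lemma plane_mx_idem : P *m P = P.
Proof.
apply/row_matrixP=> i; rewrite !rowE mulmxA; move: (delta_mx 0 i) => x.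
have xP : x *m P = x *m Sa^A *m p *m a^A + x *m Sb^A *m q *m b^A.
  by rewrite mulmxDr !mulmxA.
by rewrite [in LHS]xP plane_mxE -(mulmxA _ p p) -(mulmxA _ q q) pp q_idem.
Qed.

Lemma mxtrace_plane_mx : \tr P = 2.
Proof.
have A1 : a^A *m Sa^A = 1%:M by rewrite -map_mxM aSa map_mx1.
have A4 : b^A *m Sb^A = 1%:M by rewrite -map_mxM bSb map_mx1.
rewrite /P mxtraceD -!mulmxA mxtrace_mulC [Z in _ + Z]mxtrace_mulC -!mulmxA A1 A4.
by rewrite !mulmx1 trp mxtrace_q.
Qed.

Lemma plane_of_pts : spinor_zero_pts Q gam delta (plane_of LH).
Proof.
split; first split.
- rewrite plane_of_rowspace; exists P; split=> //; first exact: plane_mx_idem.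
  by apply: rank_of_mxtrace; rewrite ?plane_mx_idem ?mxtrace_plane_mx.
- move=> _ [x [y [Lx Hy ->]]]; rewrite quad_ab Hy ?mxE //.
  by case: ptsLH => _ _; apply.
rewrite map_top fock_add fock_vac scale1r.
set t := fock _ _ _.
suff [c1 c2] : cliff_image gam (plane_of LH) s^A /\ cliff_image gam (plane_of LH) t.
  rewrite -[s^A]scale1r; rewrite /cliff_image in c1 c2 *.
  exact: ((span_submodule _).2 1 _ _ c1 c2).
split.
(* As s is killed by every a_l, moving a_l past b_j gives s.b_j.a_l = delta_jl s. Below, a and b are
   exchanged for the top spinor, killed by every b_l. *)
- apply: (@cliff_image_trace _ p _ a (fun j => cliff_b j)) => // [j|j l].
    exists (row j p), 0; split; first by rewrite LE; apply: row_rowspace.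
      by move=> z _; rewrite trmx0 mulmx0.
    by rewrite row_mul mul0mx addr0.
  have -> : cl (row l a^A) = cliff_a l by rewrite /cliff_a inord_val.
  rewrite -mulmxA (_ : cliff_b j *m cliff_a l = (l == j)%:R%:M - cliff_a l *m
    cliff_b j); last first.
    by rewrite cliff_abA // opprB addrC subrK.
  by rewrite mulmxBr mulmxA s_cliff_a // mul0mx subr0 mul_mx_scalar eq_sym.
- apply: (@cliff_image_trace _ q _ b (fun j => cliff_a j)) => // [j||j l].
  + exists 0, (row j q); split; first by case: ptsLH => -[p' [_ -> _]] _ _;
    exists 0; rewrite ?mul0mx.
      move=> z'; rewrite HE => -[z _ <-].
      apply: trmx_inj; rewrite trmx_mul trmxK trmx_mul trmx0 mulmxA -row_mul.
      by rewrite -[q *m _]trmxK trmx_mul trmxK hqT trmx0 row0 mul0mx.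
    by rewrite row_mul mul0mx add0r.
  + exact: mxtrace_q.
  have -> : cl (row l b^A) = cliff_b l by rewrite /cliff_b inord_val.
  rewrite -mulmxA cliff_abA // mulmxBr mulmxA (fock_top_Y _ cliff_bbA cliff_b2A) //.
  by rewrite mul0mx subr0 mul_mx_scalar.
Qed.

Lemma plane_ofK : flag_of (plane_of LH) = LH.
Proof.
have A1 : a^A *m Sa^A = 1%:M by rewrite -map_mxM aSa map_mx1.
have A2 : a^A *m Sb^A = 0 by rewrite -map_mxM aSb map_mx0.
have A3 : b^A *m Sa^A = 0 by rewrite -map_mxM bSa map_mx0.
have A4 : b^A *m Sb^A = 1%:M by rewrite -map_mxM bSb map_mx1.
have rP : forall (K : fieldType) (f : {rmorphism A -> K}), \rank (map_mx f P) = 2.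
  by apply: rank_of_mxtrace; rewrite ?plane_mx_idem ?mxtrace_plane_mx.
rewrite (flag_of_rowspace plane_of_pts plane_mx_idem plane_of_rowspace rP).
have -> : a^A *m P *m Sa^A = p.
  rewrite /P mulmxDr mulmxDl !mulmxA A1 A2 mul1mx !mul0mx addr0.
  by rewrite -mulmxA A1 mulmx1.
have -> : b^A *m P *m Sb^A = q.
  rewrite /P mulmxDr mulmxDl !mulmxA A3 A4 mul1mx !mul0mx add0r.
  by rewrite -mulmxA A4 mulmx1.
rewrite /q trmxK opprB addrC subrK -LE -HE.
by case: (LH).
Qed.

End Backward.
End Points.

Let delta : 'rV[k]_N := s + fock (cliff_row gam b) s (ttop d 5).

Theorem spinor_zero_Fl : isomorphic (spinor_zero Q gam delta) (Fl k 5).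
Proof.
exists (fun A => @flag_of A); split.
  move=> A; split.
  - by move=> U /flag_of_pts.
  - move=> U U' /set_mem ptsU /set_mem ptsU' E.
    by rewrite -(flag_ofK ptsU) -(flag_ofK ptsU') E.
  - move=> LH ptsLH; have [[p [pp LE rp]] [h [hh HE rh]] _] := ptsLH.
    have trp := mxtrace_constant_rank k0 pp rp.
    have trh := mxtrace_constant_rank k0 hh rh.
    by exists (plane_of LH); [exact: (plane_of_pts ptsLH pp hh LE HE) |
      exact: (plane_ofK ptsLH pp hh LE HE)].
move=> A B f U ptsU; have [[[P [PP UE rP]] _] _] := ptsU.
have ptsfU := spinor_zero_bc_pts f ptsU.
have fUE : spinor_zero_bc f U = rowspace (map_mx f P).
  by rewrite /spinor_zero_bc UE base_change_rowspace.
rewrite (flag_of_rowspace ptsU PP UE rP) /=.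
rewrite (@flag_of_rowspace B _ (map_mx f P)) //; first last.
- by move=> K g; rewrite -map_mx_comp; apply: (rP K (g \o f)).
- by rewrite -map_mxM PP.
rewrite /Fl_bc /= !base_change_rowspace map_mxB map_mx1 -map_trmx !map_mxM.
by rewrite !map_in_alg.
Qed.
End Core.

(** * Skew 6x6 matrices and pure spinors *)

Section SkewSix.
Variable A : comNzRingType.

Section Coordinates.
Variables x v : nat -> A.

(* A skew 6x6 matrix is encoded by its 15 entries (i, j) with i < j, listed
   lexicographically. *)
Definition pfaffian : A :=
  x 0 * x 9 * x 14 - x 0 * x 10 * x 13 + x 0 * x 11 * x 12 - x 1 * x 6 * x
  14 + x 1 * x 7 * x 13 - x 1 * x 8 * x 12 + x 2 * x 5 * x 14 - x 2 * x 7 *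
  x 11 + x 2 * x 8 * x 10 - x 3 * x 5 * x 13 + x 3 * x 6 * x 11 - x 3 * x 8
  * x 9 + x 4 * x 5 * x 12 - x 4 * x 6 * x 10 + x 4 * x 7 * x 9.

(* The adjugate: entry (i, j) is the signed Pfaffian of the complementary 4x4
   block. *)
Definition sharp (i : nat) : A := nth 0 [::
  x 9 * x 14 - x 10 * x 13 + x 11 * x 12;
  - (x 6 * x 14) + x 7 * x 13 - x 8 * x 12;
  x 5 * x 14 - x 7 * x 11 + x 8 * x 10;
  - (x 5 * x 13) + x 6 * x 11 - x 8 * x 9;
  x 5 * x 12 - x 6 * x 10 + x 7 * x 9; x 2 * x 14 - x 3 * x 13 + x 4 * x 12;
  - (x 1 * x 14) + x 3 * x 11 - x 4 * x 10;
  x 1 * x 13 - x 2 * x 11 + x 4 * x 9;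
  - (x 1 * x 12) + x 2 * x 10 - x 3 * x 9; x 0 * x 14 - x 3 * x 8 + x 4 * x 7;
  - (x 0 * x 13) + x 2 * x 8 - x 4 * x 6; x 0 * x 12 - x 2 * x 7 + x 3 * x 6;
  x 0 * x 11 - x 1 * x 8 + x 4 * x 5; - (x 0 * x 10) + x 1 * x 7 - x 3 * x 5;
  x 0 * x 9 - x 1 * x 6 + x 2 * x 5] i.

(* Coordinate I, a subset of {0, .., 4} read in binary, of the pure spinor
   attached to x is the Pfaffian of x on I or on I + {5}, whichever is even. *)
Definition pure_coord (i : nat) : A := nth 0 [::
  1; x 4; x 8; x 0; x 11; x 1; x 5; x 0 * x 11 - x 1 * x 8 + x 4 * x 5; x 13;
  x 2; x 6; x 0 * x 13 - x 2 * x 8 + x 4 * x 6; x 9;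
  x 1 * x 13 - x 2 * x 11 + x 4 * x 9; x 5 * x 13 - x 6 * x 11 + x 8 * x 9;
  x 0 * x 9 - x 1 * x 6 + x 2 * x 5; x 14; x 3; x 7;
  x 0 * x 14 - x 3 * x 8 + x 4 * x 7; x 10;
  x 1 * x 14 - x 3 * x 11 + x 4 * x 10; x 5 * x 14 - x 7 * x 11 + x 8 * x 10;
  x 0 * x 10 - x 1 * x 7 + x 3 * x 5; x 12;
  x 2 * x 14 - x 3 * x 13 + x 4 * x 12; x 6 * x 14 - x 7 * x 13 + x 8 * x 12;
  x 0 * x 12 - x 2 * x 7 + x 3 * x 6; x 9 * x 14 - x 10 * x 13 + x 11 * x 12;
  x 1 * x 12 - x 2 * x 10 + x 3 * x 9; x 5 * x 12 - x 6 * x 10 + x 7 * x 9;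
    pfaffian] i.

(** Applied to [pure_coord x], [coordB] returns x and [coordC] returns [sharp x]: these are the
    blocks B and C of a spinor, between the entries v_0 and v_31. *)
Definition coordB (i : nat) : A := nth 0 [::
  v 3; v 5; v 9; v 17; v 1; v 6; v 10; v 18; v 2; v 12; v 20; v 4; v 24; v 8;
  v 16] i.

Definition coordC (i : nat) : A := nth 0 [::
  v 28; - v 26; v 22; - v 14; v 30; v 25; - v 21; v 13; - v 29; v 19; - v 11;
  v 27; v 7; - v 23; v 15] i.

Definition skew6 (i j : nat) : A := nth 0 (nth [::] [::
  [:: 0; x 0; x 1; x 2; x 3; x 4];
  [:: - x 0; 0; x 5; x 6; x 7; x 8];
  [:: - x 1; - x 5; 0; x 9; x 10; x 11];
  [:: - x 2; - x 6; - x 9; 0; x 12; x 13];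
  [:: - x 3; - x 7; - x 10; - x 12; 0; x 14];
  [:: - x 4; - x 8; - x 11; - x 13; - x 14; 0]] i) j.

End Coordinates.

Definition dotB (x y : nat -> A) : A := \sum_(i < 15) x i * y i.

Lemma sharpZ c x i : (i < 15)%N -> sharp (fun j => c * x j) i = c ^+ 2 * sharp x i.
Proof. by do 15? [case: i => [_|i]; first by rewrite /sharp /=; ring]. Qed.

Lemma pfaffianZ c x : pfaffian (fun j => c * x j) = c ^+ 3 * pfaffian x.
Proof. by rewrite /pfaffian; ring. Qed.

(** The adjoint identity of a cubic norm; it lets [sharp z] be prescribed up to scale by taking z
    itself proportional to a [sharp]. *)
Lemma sharpK x i : (i < 15)%N -> sharp (sharp x) i = pfaffian x * x i.
Proof. by do 15? [case: i => [_|i]; first by rewrite /sharp /pfaffian /=;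
  ring]. Qed.

Lemma pfaffian_sharp x : pfaffian (sharp x) = pfaffian x ^+ 2.
Proof. by rewrite /pfaffian /sharp /=; ring. Qed.

(** The weights l, m against the displacements m z, -l z are chosen so that the terms linear in z
    cancel. *)
Lemma sharp_mix l m b z i : (i < 15)%N ->
  l * sharp (fun j => b j + m * z j) i + m * sharp (fun j => b j - l * z j) i =
  (l + m) * (sharp b i + l * m * sharp z i).
Proof. by do 15? [case: i => [_|i]; first by rewrite /sharp /=; ring]. Qed.

Lemma pfaffian_mix l m b z :
  l * pfaffian (fun j => b j + m * z j) + m * pfaffian (fun j => b j - l * z j) =
  (l + m) * (pfaffian b + l * m * dotB b (sharp z) + l * m * (m - l) * pfaffian z).
Proof.
by rewrite /pfaffian /dotB !big_ord_recl big_ord0 /sharp /=; ring.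
Qed.

End SkewSix.

(** * A general spinor as a sum of two pure ones *)

Section Decomposition.
Variables (k : fieldType) (k0 : [pchar k] =i pred0) (v : nat -> k).

Local Notation B := (coordB v).

(* Looking for v = l pure(x) + m pure(y) with x = (B + m z) / v_0 and
   y = (B - l z) / v_0, one is led to l + m = v_0, l m z# = D and
   l m (m - l) Pf z = E, hence to z proportional to D#. *)
Definition quarticD (i : nat) : k := v 0 * coordC v i - sharp B i.
Definition quarticP : k := pfaffian quarticD.
Definition quarticE : k := v 0 ^+ 2 * v 31 - pfaffian B - dotB B quarticD.
Definition quartic_disc : k := 4 * quarticP + quarticE ^+ 2.

Lemma pure_decomposition (r : k) : v 0 != 0 -> quarticP != 0 ->
  quartic_disc != 0 -> r ^+ 2 = quartic_disc ->
  exists (l m : k) (x y : nat -> k), [/\ l != 0, m != 0,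
    pfaffian (fun j => x j - y j) != 0 &
    forall i, (i < 32)%N -> v i = l * pure_coord x i + m * pure_coord y i].
Proof.
move=> v0 P0 R0 rR; have r0 : r != 0 by apply: contra_neq R0 => r0;
  rewrite -rR r0 expr0n.
have /pcharf0P k0' := k0.
have n2 : (2 : k) != 0 by rewrite k0'.
have n4 : (4 : k) != 0 by rewrite k0'.
(* With z = c D# and P = Pf D one has z# = c^2 P D and Pf z = c^3 P^2, so the conditions read l m
   c^2 P = 1 and (m - l) c P = E. Inserting them in (l + m)^2 - (m - l)^2 = 4 l m gives (v_0 c P)^2
   = E^2 + 4 P = r^2; then [d] is m - l. *)
pose c := r / (v 0 * quarticP).
pose z j := c * sharp quarticD j.
pose d := quarticE * v 0 / r.
pose m := (v 0 + d) / 2; pose l := (v 0 - d) / 2.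
have lm : l + m = v 0 by rewrite /l /m; field.
have lmE : l * m * (c ^+ 2 * quarticP) = 1.
  have -> : l * m * (c ^+ 2 * quarticP) = (r ^+ 2 - quarticE ^+ 2) / (4 * quarticP).
    by rewrite /l /m /c /d; field; rewrite r0 v0 P0 n2 n4.
  by rewrite rR /quartic_disc addrK divff // mulf_neq0 // k0'.
have dE : (m - l) * (c * quarticP) = quarticE.
  by rewrite /l /m /c /d; field; rewrite r0 v0 P0 n2.
have pz : pfaffian z = c ^+ 3 * quarticP ^+ 2 by rewrite pfaffianZ pfaffian_sharp.
have c0 : c != 0 by rewrite mulf_neq0 // invr_eq0 mulf_neq0.
have lm0 : l * m != 0.
  by apply/eqP => E; move/eqP: lmE; rewrite E mul0r eq_sym oner_eq0.
have l0 : l != 0 by apply: contra_neq lm0 => ->; rewrite mul0r.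
have m0 : m != 0 by apply: contra_neq lm0 => ->; rewrite mulr0.
pose x j := (v 0)^-1 * (B j + m * z j); pose y j := (v 0)^-1 * (B j - l * z j).
have sharp_xy i : (i < 15)%N -> l * sharp x i + m * sharp y i = coordC v i.
  move=> i15; rewrite !sharpZ // mulrCA [m * _]mulrCA -mulrDr sharp_mix // lm.
  rewrite sharpZ // sharpK // -/quarticP.
  have -> : l * m * (c ^+ 2 * (quarticP * quarticD i)) = l * m * (c ^+ 2 *
    quarticP) * quarticD i by ring.
  rewrite lmE mul1r /quarticD addrC subrK; field.
  by rewrite v0.
have pf_xy : l * pfaffian x + m * pfaffian y = v 31.
  rewrite !pfaffianZ mulrCA [m * _]mulrCA -mulrDr pfaffian_mix lm pz.
  have -> : l * m * dotB B (sharp z) = dotB B quarticD.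
    rewrite /dotB mulr_sumr; apply: eq_bigr => i _.
    rewrite sharpZ // sharpK // -/quarticP -[RHS]mul1r -lmE; ring.
  have -> : l * m * (m - l) * (c ^+ 3 * quarticP ^+ 2) = quarticE.
    by rewrite -dE -[RHS]mul1r -lmE; ring.
  by rewrite /quarticE; field; rewrite v0.
have lin j : l * x j + m * y j = B j.
  by rewrite /x /y -lm; field; rewrite lm.
exists l, m, x, y; split=> //.
  have -> : (fun j => x j - y j) = z.
    by apply/funext => j; rewrite /x /y -lm; field; rewrite lm.
  by rewrite pz mulf_neq0 // expf_neq0.
clearbody x y.
(* Some quadratic coordinates of a pure spinor are minus an entry of [sharp]. *)
have neg i e : (i < 15)%N -> coordC v i = - e ->
  e = - (l * sharp x i + m * sharp y i).
  by move=> i15 E; rewrite sharp_xy // E opprK.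
case=> [_|i]; first by rewrite /pure_coord /= -lm; ring.
case: i => [_|i]; first exact: (esym (lin 4%N)).
case: i => [_|i]; first exact: (esym (lin 8%N)).
case: i => [_|i]; first exact: (esym (lin 0%N)).
case: i => [_|i]; first exact: (esym (lin 11%N)).
case: i => [_|i]; first exact: (esym (lin 1%N)).
case: i => [_|i]; first exact: (esym (lin 5%N)).
case: i => [_|i]; first exact: (esym (sharp_xy 12%N isT)).
case: i => [_|i]; first exact: (esym (lin 13%N)).
case: i => [_|i]; first exact: (esym (lin 2%N)).
case: i => [_|i]; first exact: (esym (lin 6%N)).
case: i => [_|i]; first by rewrite [LHS](neg 10%N _ isT erefl) /pure_coord
  /sharp /=; ring.
case: i => [_|i]; first exact: (esym (lin 9%N)).
case: i => [_|i]; first exact: (esym (sharp_xy 7%N isT)).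
case: i => [_|i]; first by rewrite [LHS](neg 3%N _ isT erefl) /pure_coord
  /sharp /=; ring.
case: i => [_|i]; first exact: (esym (sharp_xy 14%N isT)).
case: i => [_|i]; first exact: (esym (lin 14%N)).
case: i => [_|i]; first exact: (esym (lin 3%N)).
case: i => [_|i]; first exact: (esym (lin 7%N)).
case: i => [_|i]; first exact: (esym (sharp_xy 9%N isT)).
case: i => [_|i]; first exact: (esym (lin 10%N)).
case: i => [_|i]; first by rewrite [LHS](neg 6%N _ isT erefl) /pure_coord
  /sharp /=; ring.
case: i => [_|i]; first exact: (esym (sharp_xy 2%N isT)).
case: i => [_|i]; first by rewrite [LHS](neg 13%N _ isT erefl) /pure_coord
  /sharp /=; ring.
case: i => [_|i]; first exact: (esym (lin 12%N)).
case: i => [_|i]; first exact: (esym (sharp_xy 5%N isT)).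
case: i => [_|i]; first by rewrite [LHS](neg 1%N _ isT erefl) /pure_coord
  /sharp /=; ring.
case: i => [_|i]; first exact: (esym (sharp_xy 11%N isT)).
case: i => [_|i]; first exact: (esym (sharp_xy 0%N isT)).
case: i => [_|i]; first by rewrite [LHS](neg 8%N _ isT erefl) /pure_coord
  /sharp /=; ring.
case: i => [_|i]; first exact: (esym (sharp_xy 4%N isT)).
case: i => [_|i]; first exact: (esym pf_xy).
by [].
Qed.
End Decomposition.

Section PureKilled.
Variables (A : comNzRingType) (x : nat -> A).

Local Arguments addn : simpl nomatch.
Local Arguments muln : simpl nomatch.
Local Arguments expn : simpl nomatch.

(** Index 5 of the skew matrix is the direction of e. The term - x_i5 x_j5 compensates the product
    of the e-components, so that these annihilating vectors are mutually orthogonal. *)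
Lemma pure_killed i : (i < 5)%N ->
  cliff_op (fun j => (j == i)%:R) (fun j => skew6 x i j - skew6 x i 5 * skew6 x j 5)
    (- skew6 x i 5) (tree_of (pure_coord x) 5) = tcst 0 5.
Proof.
by do 5? [case: i => [_|i]; first by
  rewrite /= /skew6 /pure_coord /pfaffian /=; do 31? [apply: f_equal2]; ring].
Qed.

End PureKilled.

Section SkewPf.
Variable k : comNzRingType.
Lemma skew6_sharp (z : nat -> k) i j : (i < 6)%N -> (j < 6)%N ->
  \sum_(l < 6) skew6 z i l * skew6 (sharp z) l j = - (i == j)%:R * pfaffian z.
Proof.
rewrite !big_ord_recl big_ord0.
by do 6? [case: i => [_|i]; first by do 6? [case: j => [_|j];
  first by rewrite /skew6 /sharp /pfaffian /=; ring]].
Qed.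

End SkewPf.

(** * Duality of two annihilators *)

Section Pairing.
Variables (k : fieldType) (k0 : [pchar k] =i pred0).

Definition skewmx (z : nat -> k) : 'M[k]_(5 + 1) := \matrix_(i, j) skew6 z i j.

Lemma skewmx_unit z : pfaffian z != 0 -> skewmx z \in unitmx.
Proof.
move=> pf0; have /mulmx1_unit [] // :
    skewmx z *m ((- (pfaffian z)^-1) *: skewmx (sharp z)) = 1%:M.
rewrite -scalemxAr; apply/matrixP=> i j; rewrite !mxE.
under eq_bigr => l _ do rewrite !mxE.
rewrite (skew6_sharp z (ltn_ord i) (ltn_ord j)) -val_eqE /=.
by case: eqP => _; rewrite ?oppr0 ?mul0r ?mulr0 // !mulNr mul1r mulrN opprK mulVf.
Qed.

Lemma skew6C (z : nat -> k) i j : (i < 6)%N -> (j < 6)%N ->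
  skew6 z j i = - skew6 z i j.
Proof.
by do 6? [case: i => [_|i]; first by do 6? [case: j => [_|j];
  first by rewrite /skew6 /= ?opprK ?oppr0]].
Qed.

Lemma skewmx_tr (z : nat -> k) : (skewmx z)^T = - skewmx z.
Proof. by apply/matrixP=> i j; rewrite !mxE skew6C. Qed.

Lemma double_eq0 (c : k) : c = - c -> c = 0.
Proof.
have /pcharf0P k0' := k0; move/eqP; rewrite -addr_eq0 -mulr2n -mulr_natl mulf_eq0.
by rewrite k0' /= => /eqP.
Qed.

(* The matrix is [1 s] Z [1 t]^T with Z = skewmx z; the kernels of [1 s] and [1 t]
   are spanned by n1 = (-s, 1) and n2 = (-t, 1), and n2 Z^-1 n1^T = -1. *)
Lemma skew_pairing_unit (z : nat -> k) (s t : 'cV[k]_5) : pfaffian z != 0 ->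
  (forall i, s i 0 - t i 0 = skew6 z i 5) ->
  (\matrix_(i, j) (skew6 z i j - s i 0 * (s j 0 - t j 0) + (s i 0 - t i 0) * t j 0))
    \in unitmx.
Proof.
move=> pf0 st; set K := (K in K \in _).
have Zu := skewmx_unit pf0; set Z := skewmx z in Zu.
have KE : K = row_mx 1%:M s *m Z *m (row_mx 1%:M t)^T.
  rewrite -[Z]submxK mul_row_block !mul1mx tr_row_mx trmx1 mul_row_col mulmx1.
  apply/matrixP=> i j; rewrite !mxE !big_ord1 !mxE !big_ord1 !mxE /= !addn0.
  have z55 : skew6 z 5 5 = 0 by [].
  by rewrite z55 -st (skew6C z (ltnW (ltn_ord j) : (j < 6)%N) (isT :
    (5 < 6)%N)) // -st; ring.
rewrite -row_free_unit; apply: inj_row_free => u; rewrite KE !mulmxA.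
set w := u *m row_mx 1%:M s => wZt.
pose n1 : 'rV[k]_(5 + 1) := row_mx (- s^T) 1%:M.
pose n2 : 'rV[k]_(5 + 1) := row_mx (- t^T) 1%:M.
have wn1 : w *m n1^T = 0.
  by rewrite -mulmxA tr_row_mx mul_row_col linearN /= trmxK trmx1 mul1mx mulmx1
    addNr mulmx0.
(* The row w Z is killed by [1 t]^T, hence equals mu n2. As n2 is n1 minus the last row of Z and
   Z^-1 is skew, pairing with Z^-1 n1^T gives -mu = w n1^T = 0. *)
pose mu := rsubmx (w *m Z).
have wZ : w *m Z = mu *m n2.
  have lE : lsubmx (w *m Z) = - (mu *m t^T).
    have : w *m Z *m (row_mx 1%:M t)^T = 0 by [].
    rewrite -{1}[w *m Z]hsubmxK tr_row_mx mul_row_col trmx1 mulmx1 => /eqP.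
    by rewrite addr_eq0 => /eqP.
  by rewrite -[LHS]hsubmxK lE /n2 mul_mx_row mulmx1 mulmxN.
have n12 : n2 = n1 - delta_mx 0 (rshift 5 0) *m Z.
  rewrite -rowE; apply/matrixP=> i j; rewrite !mxE ord1.
  case: (splitP j) => j' jE; rewrite !mxE.
    rewrite /= addn0 jE (skew6C z (ltnW (ltn_ord j') : (j' < 6)%N) (isT :
      (5 < 6)%N)) // -st opprK; ring.
  by rewrite /= (ord1 j') in jE *; rewrite jE subr0.
have mu0 : mu = 0.
  have : mu *m n2 *m invmx Z *m n1^T = 0 by rewrite -wZ mulmxK.
  rewrite n12 mulmxBr !mulmxBl (mulmxA mu) mulmxK // -!mulmxA.
  have -> : n1 *m (invmx Z *m n1^T) = 0.
    apply/matrixP=> i j; rewrite !ord1 [RHS]mxE; apply: double_eq0.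
    have NZ : - Z \in unitmx by rewrite -scaleN1r unitmxZ ?unitrN1.
    have invN : invmx (- Z) = - invmx Z.
      by rewrite -[LHS]mulmx1 -(mulmxV Zu) -{2}[Z]opprK mulNmx mulmxN mulmxA
        mulVmx ?mul1mx.
    have T : (n1 *m (invmx Z *m n1^T))^T = - (n1 *m (invmx Z *m n1^T)).
      by rewrite !trmx_mul trmxK trmx_inv skewmx_tr invN mulmxN mulNmx mulmxA.
    by have := congr1 (fun F : 'M_1 => F 0 0) T; rewrite mxE [RHS]mxE.
  rewrite mulmx0 sub0r tr_row_mx -[delta_mx _ _ *m _]rowE.
  have -> : row (rshift 5 0) (col_mx (- s^T)^T 1%:M^T) = 1%:M :> 'M[k]_1.
    by rewrite rowKd; apply/matrixP=> i j; rewrite !mxE !ord1.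
  by rewrite mulmx1 => /eqP; rewrite oppr_eq0 => /eqP.
have w0 : w = 0 by rewrite -[w](mulmxK Zu) wZ mu0 !mul0mx.
by move: w0; rewrite /w mul_mx_row mulmx1 -row_mx0 => /eq_row_mx [].
Qed.

End Pairing.

(** * General spinors *)

Lemma symmetric_anisotropic (k : fieldType) n (Q : 'M[k]_n) : (2 : k) != 0 ->
  Q^T = Q -> Q != 0 -> exists v : 'rV[k]_n, (v *m Q *m v^T) 0 0 != 0.
Proof.
move=> n2 Qsym; apply: contra_neqP => noV.
have q0 (v : 'rV[k]_n) : (v *m Q *m v^T) 0 0 = 0.
  by apply/eqP/negPn/negP => v0; apply: noV; exists v.
have DE (F G : 'M[k]_1) : (F + G) 0 0 = F 0 0 + G 0 0 by rewrite mxE.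
have T1 (F : 'M[k]_1) : F^T = F by apply/matrixP=> i j; rewrite mxE !ord1.
have b0 (u v : 'rV[k]_n) : (u *m Q *m v^T) 0 0 = 0.
  have := q0 (u + v); rewrite linearD /= !mulmxDl !mulmxDr !DE !q0 add0r addr0.
  have -> : v *m Q *m u^T = u *m Q *m v^T.
    by rewrite -[LHS]T1 !trmx_mul !trmxK Qsym mulmxA.
  by rewrite -mulr2n -mulr_natl => /eqP; rewrite mulf_eq0 (negPf n2) => /eqP.
apply/matrixP=> i j; rewrite [RHS]mxE -(b0 (delta_mx 0 i) (delta_mx 0 j)).
by rewrite -rowE trmx_delta -colE !mxE.
Qed.

(** Induction: a non-isotropic vector is scaled to norm 1 by a square root, and the form restricted
    to its orthogonal is again non-degenerate. *)
Lemma orthonormal_basis (k : numClosedFieldType) n (Q : 'M[k]_n) :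
  Q^T = Q -> Q \in unitmx -> exists T : 'M[k]_n, T *m Q *m T^T = 1%:M.
Proof.
elim: n Q => [|n IH] Q Qsym Qu.
  by exists 0; apply/matrixP=> -[].
have Q0 : Q != 0.
  apply: contraTneq Qu => ->; rewrite unitmxE det0 unitr0 //.
have n2 : (2 : k) != 0 by rewrite pnatr_eq0.
have [v' v0] := symmetric_anisotropic n2 Qsym Q0.
set c := (_ 0 0) in v0; pose v := (sqrtC c)^-1 *: v'.
have vv : v *m Q *m v^T = 1%:M.
  rewrite [LHS]mx11_scalar /v linearZ /= -!(scalemxAl, scalemxAr) scalerA mxE.
  by rewrite -/c -invfM -expr2 sqrtCK mulVf.
pose w := Q *m v^T; have vw : v *m w = 1%:M by rewrite mulmxA.
have rw : \rank w = 1.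
  apply/eqP; rewrite eqn_leq rank_leq_col lt0n mxrank_eq0.
  by apply: contra_eq_neq vw => ->; rewrite mulmx0 eq_sym -[1%:M]/1 oner_eq0.
have [B [Bfree Bw]] : exists B : 'M[k]_(n, n.+1), row_free B /\ B *m w = 0.
  suff W r : r = n -> (exists B : 'M[k]_(r, n.+1), row_free B /\ B *m w = 0) ->
    exists B : 'M[k]_(n, n.+1), row_free B /\ B *m w = 0.
    apply: (W (\rank (kermx w))); first by rewrite mxrank_ker rw subn1.
    exists (row_base (kermx w)); split; first exact: row_base_free.
    by apply/eqP; rewrite -sub_kermx eq_row_base.
  by move=> ->.
pose T0 : 'M[k]_(1 + n) := col_mx v B.
have T0u : T0 \in unitmx.
  rewrite -row_free_unit; apply: inj_row_free => x;
    rewrite -[x]hsubmxK mul_row_col => x0.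
  have x1 : lsubmx x = 0.
    have := congr1 (mulmx^~ w) x0; rewrite mulmxDl -!mulmxA vw Bw mulmx0 addr0.
    by rewrite mulmx1 mul0mx.
  move: x0; rewrite x1 mul0mx add0r => /eqP; rewrite mulmx_free_eq0 // => /eqP ->.
  exact: row_mx0.
have vB : v *m Q *m B^T = 0.
  by apply: trmx_inj; rewrite !trmx_mul trmxK Qsym trmx0.
pose Q' := B *m Q *m B^T.
have Q'sym : Q'^T = Q' by rewrite !trmx_mul trmxK Qsym mulmxA.
have Q'u : Q' \in unitmx.
  have TQT : col_mx v B *m Q *m (col_mx v B)^T = block_mx 1%:M 0 0 Q'.
    by rewrite mul_col_mx tr_col_mx mul_col_row vv vB -(mulmxA B) Bw.
  have : T0 *m Q *m T0^T \in unitmx by rewrite !unitmx_mul T0u Qu unitmx_tr T0u.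
  by rewrite [T0 *m _ *m _]TQT unitmxE det_ublock det1 mul1r.
have [T' T'E] := IH Q' Q'sym Q'u.
exists (col_mx v (T' *m B) : 'M[k]_(1 + n)).
suff : col_mx v (T' *m B) *m Q *m (col_mx v (T' *m B))^T = block_mx 1%:M 0 0 1%:M.
  by rewrite -scalar_mx_block.
rewrite mul_col_mx tr_col_mx mul_col_row vv !trmx_mul mulmxA vB mul0mx.
rewrite -!(mulmxA T') -(mulmxA B) Bw mulmx0.
have -> // : T' *m (B *m Q *m (B^T *m T'^T)) = 1%:M.
by rewrite -T'E /Q' !mulmxA.
Qed.

(** * From a pair of pure spinors to adapted coordinates *)

Section PurePair.
Variables (k : numClosedFieldType) (Q : 'M[k]_11) (gam : 'I_11 -> 'M[k]_32).
Hypotheses (Qsym : Q^T = Q) (Qu : Q \in unitmx).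
Hypothesis polar : forall u v : 'rV[k]_11,
  cliff gam u *m cliff gam v + cliff gam v *m cliff gam u =
    (2 * (u *m Q *m v^T) 0 0)%:M.

Lemma numClosed_pchar0 : [pchar k] =i pred0. Proof. exact: pchar_num. Qed.

Section Basis.
Variables (a b : 'M[k]_(5, 11)) (s : 'rV[k]_32).
Hypotheses (bQb : b *m Q *m b^T = 0) (aQb : a *m Q *m b^T = (2^-1)%:M).
Hypotheses (s_neq0 : s != 0) (sa : forall i, s *m cliff gam (row i a) = 0).

Local Notation fk := (fock (cliff_row gam b) s).
Let XY := cliff_row_ab numClosed_pchar0 polar aQb.
Let YY := cliff_row_bb polar bQb.
Let Y0 := cliff_row_b2 numClosed_pchar0 polar bQb.

Let sX i : (i < 5)%N -> s *m cliff_row gam a i = 0.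
Proof. by move=> _; apply: sa. Qed.

Lemma s_free c : c *: s = 0 -> c = 0.
Proof. by move/eqP; rewrite scaler_eq0 (negPf s_neq0) orbF => /eqP. Qed.

Definition fock_row (v : 'rV[k]_32) : 'rV[k]_32 :=
  fk (tree_of (fun i => v 0 (inord i)) 5).

Lemma fock_row_linear : linear fock_row.
Proof.
move=> c u v; rewrite /fock_row -fock_scale -fock_add -tree_of_scale -tree_of_add.
by congr (fock _ _ (tree_of _ 5)); apply/funext => i; rewrite !mxE.
Qed.

HB.instance Definition _ :=
  GRing.isLinear.Build k 'rV[k]_32 'rV[k]_32 _ fock_row fock_row_linear.

(** As 32 = 2^5, the injective Fock map is bijective and every spinor has exterior coordinates. *)
Lemma fock_basis : exists2 M : 'M[k]_32, M \in unitmx &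
  forall x : 'rV[k]_32, x = fk (tree_of (fun i => (x *m M) 0 (inord i)) 5).
Proof.
pose L := lin1_mx fock_row.
have Lu : L \in unitmx.
  rewrite -row_free_unit; apply: inj_row_free => v; rewrite mul_rV_lin1 /= => v0.
  have v00 : fock_row v = fock_row 0 by rewrite v0 linear0.
  have /tree_of_inj E := fock_inj (m := 5) XY sX (leqnn 5) s_free v00.
  apply/rowP => i; have := E i (ltn_ord i); rewrite inord_val => ->.
  by rewrite mxE.
exists (invmx L); first by rewrite unitmx_inv.
by move=> x; rewrite -[LHS](mulmxKV Lu) mul_rV_lin1.
Qed.

Hypothesis aQa : a *m Q *m a^T = 0.

(** Ten linear conditions in dimension 11 leave a vector, non-isotropic since Q is non-degenerate.
    It anticommutes with the rows of a, so it preserves the vacuum line and acts there by some c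
    with c^2 = 1; multiplying the vector by c makes the action trivial. *)
Lemma hyperbolic_complement : exists e : 'rV[k]_11,
  [/\ e *m Q *m a^T = 0, e *m Q *m b^T = 0, e *m Q *m e^T = 1%:M &
      s *m cliff gam e = s].
Proof.
have n2 : (2 : k) != 0 by rewrite pnatr_eq0.
have bQa : b *m Q *m a^T = (2^-1)%:M.
  by apply: trmx_inj; rewrite !trmx_mul trmxK Qsym mulmxA aQb tr_scalar_mx.
pose F : 'M[k]_(11, 5 + 5) := Q *m (col_mx a b)^T.
have [e0 e0_neq0 e0F] : exists2 e0 : 'rV[k]_11, e0 != 0 & e0 *m F = 0.
  have : kermx F != 0.
    rewrite -mxrank_eq0 mxrank_ker -lt0n subn_gt0.
    by apply: leq_ltn_trans (rank_leq_col F) _.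
  move=> /rowV0Pn [e0 eker e0n]; exists e0 => //.
  by apply/eqP; rewrite -sub_kermx.
have [e0a e0b] : e0 *m Q *m a^T = 0 /\ e0 *m Q *m b^T = 0.
  by move: e0F; rewrite /F mulmxA tr_col_mx mul_mx_row -row_mx0 => /eq_row_mx.
have half_inj (u : 'rV[k]_5) : u *m (2^-1)%:M = 0 -> u = 0.
  by rewrite mul_mx_scalar => /eqP; rewrite scaler_eq0 invr_eq0 (negPf n2) => /eqP.
pose T : 'M[k]_(5 + 5 + 1) := col_mx (col_mx a b) e0.
have Tu : T \in unitmx.
  rewrite -row_free_unit; apply: inj_row_free => x.
  rewrite -[x]hsubmxK -[lsubmx x]hsubmxK !mul_row_col.
  set x1 := lsubmx (lsubmx x); set x2 := rsubmx (lsubmx x);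
    set x3 := rsubmx x => x0.
  have x10 : x1 = 0.
    apply: half_inj; have := congr1 (fun y => y *m Q *m b^T) x0.
    rewrite !mulmxDl -!mulmxA !(mulmxA _ Q) aQb bQb e0b !mulmx0 !addr0 => ->.
    by rewrite !mul0mx.
  have x20 : x2 = 0.
    apply: half_inj; have := congr1 (fun y => y *m Q *m a^T) x0.
    rewrite !mulmxDl -!mulmxA !(mulmxA _ Q) aQa bQa e0a !mulmx0 addr0 add0r => ->.
    by rewrite !mul0mx.
  move: x0; rewrite x10 x20 !mul0mx !add0r row_mx0 [x3]mx11_scalar
    mul_scalar_mx => /eqP.
  by rewrite scaler_eq0 (negPf e0_neq0) orbF => /eqP ->; rewrite raddf0 row_mx0.
have q0 : (e0 *m Q *m e0^T) 0 0 != 0.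
  apply: contra_neq e0_neq0 => q0.
  have qe : e0 *m Q *m e0^T = 0 by rewrite [LHS]mx11_scalar q0 raddf0.
  have TQe : T *m (Q *m e0^T) = 0.
    rewrite /T mul_col_mx mul_col_mx !mulmxA qe.
    have -> : a *m Q *m e0^T = 0.
      by apply: trmx_inj; rewrite !trmx_mul trmxK Qsym mulmxA e0a trmx0.
    have -> : b *m Q *m e0^T = 0.
      by apply: trmx_inj; rewrite !trmx_mul trmxK Qsym mulmxA e0b trmx0.
    by rewrite !col_mx0.
  have Qe : Q *m e0^T = 0 by rewrite -[LHS](mulKmx Tu) TQe mulmx0.
  by apply: trmx_inj; rewrite trmx0 -[LHS](mulKmx Qu) Qe mulmx0.
pose e1 := (sqrtC ((e0 *m Q *m e0^T) 0 0))^-1 *: e0.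
have e1a : e1 *m Q *m a^T = 0 by rewrite /e1 -!scalemxAl e0a scaler0.
have e1b : e1 *m Q *m b^T = 0 by rewrite /e1 -!scalemxAl e0b scaler0.
have e11 : e1 *m Q *m e1^T = 1%:M.
  rewrite [LHS]mx11_scalar /e1 linearZ /= -!(scalemxAl, scalemxAr) scalerA mxE.
  by rewrite -invfM -expr2 sqrtCK mulVf.
clearbody e1.
have e1X i : (i < 5)%N -> cliff gam e1 *m cliff_row gam a i =
    - (cliff_row gam a i *m cliff gam e1).
  move=> _; apply: (addIr (cliff_row gam a i *m cliff gam e1)); rewrite addNr.
  by rewrite -[e1](row_id 0) polar row_form e1a mxE mulr0 raddf0.
have [M _ Mfock] := fock_basis.
have [c cE] : exists c, s *m cliff gam e1 = c *: s.
  rewrite [s *m _]Mfock; apply: (fock_killed_X (m := 5) XY sX) => // i i5.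
  by rewrite -Mfock -mulmxA e1X // mulmxN mulmxA sX // mul0mx oppr0.
have c2 : c * c = 1.
  have ee : cliff gam e1 *m cliff gam e1 = 1%:M.
    have := polar e1 e1; rewrite e11 -mulr2n mxE mulr1 -[_ *+ 2]scaler_nat => E.
    by apply: (scalerI n2); rewrite E scale_scalar_mx mulr1.
  apply/eqP; rewrite -subr_eq0; apply/eqP/s_free.
  by rewrite scalerBl scale1r -scalerA -cE scalemxAl -cE -mulmxA ee mulmx1 subrr.
exists (c *: e1); split.
- by rewrite -!scalemxAl e1a scaler0.
- by rewrite -!scalemxAl e1b scaler0.
- by rewrite linearZ /= -!(scalemxAl, scalemxAr) e11 scalerA c2 scale1r.
- by rewrite linearZ /= -scalemxAr cE scalerA c2 scale1r.
Qed.

Lemma killed_top (t : 'rV[k]_32) : (forall i, t *m cliff gam (row i b) = 0) ->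
  exists d, t = fk (ttop d 5).
Proof.
move=> tb; have [M _ Mfock] := fock_basis.
rewrite [t]Mfock; apply: (fock_killed_Y (m := 5) XY YY Y0 sX) => // i i5.
by rewrite -Mfock; apply: tb.
Qed.

End Basis.

Lemma pure_pair_iso (W1 W2 : 'M[k]_(5, 11)) (s1 s2 : 'rV[k]_32) :
  s1 != 0 -> s2 != 0 ->
  (forall i, s1 *m cliff gam (row i W1) = 0) ->
  (forall i, s2 *m cliff gam (row i W2) = 0) ->
  W1 *m Q *m W2^T \in unitmx ->
  isomorphic (spinor_zero Q gam (s1 + s2)) (Fl k 5).
Proof.
move=> s1n s2n s1W s2W Ku.
have n2 : (2 : k) != 0 by rewrite pnatr_eq0.
have iso (s : 'rV[k]_32) (W : 'M[k]_(5, 11)) : s != 0 ->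
    (forall i, s *m cliff gam (row i W) = 0) -> W *m Q *m W^T = 0.
  move=> sn sW; apply/matrixP=> i j; rewrite [RHS]mxE -row_form.
  have := congr1 (mulmx s) (polar (row i W) (row j W)).
  rewrite mulmxDr !mulmxA !sW !mul0mx addr0 mul_mx_scalar => /esym/eqP.
  by rewrite scaler_eq0 (negPf sn) orbF mulf_eq0 (negPf n2) => /eqP.
set K := W1 *m Q *m W2^T in Ku.
(* The basis of the second annihilator dual to [W1], with pairing normalised to 1/2. *)
pose b := 2^-1 *: ((invmx K)^T *m W2).
have aQa := iso _ _ s1n s1W.
have s2b i : s2 *m cliff gam (row i b) = 0.
  rewrite /b linearZ /= row_mul linearZ /= -scalemxAr cliff_mulmx mulmx_sumr
    big1 ?scaler0 // => j _.
  by rewrite -scalemxAr s2W scaler0.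
have bQb := iso _ _ s2n s2b.
have aQb : W1 *m Q *m b^T = (2^-1)%:M.
  rewrite /b linearZ /= trmx_mul trmxK -scalemxAr mulmxA -/K mulmxV //.
  by rewrite scale_scalar_mx mulr1.
have bQa : b *m Q *m W1^T = (2^-1)%:M.
  by apply: trmx_inj; rewrite !trmx_mul trmxK Qsym mulmxA aQb tr_scalar_mx.
have [e [eQa eQb eQe se]] := hyperbolic_complement bQb aQb s1n s1W aQa.
have [d dE] := killed_top bQb aQb s1n s1W s2b.
have d0 : d != 0.
  apply: contra_neq s2n => d0; rewrite dE d0.
  suff -> : ttop (0 : k) 5 = tcst 0 5 by rewrite fock_cst0.
  by [].
have aQe : W1 *m Q *m e^T = 0.
  by apply: trmx_inj; rewrite !trmx_mul trmxK Qsym mulmxA eQa trmx0.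
have bQe : b *m Q *m e^T = 0.
  by apply: trmx_inj; rewrite !trmx_mul trmxK Qsym mulmxA eQb trmx0.
pose Sa := 2 *: (Q *m b^T); pose Sb := 2 *: (Q *m W1^T); pose Sc := Q *m e^T.
have hS (V : 'M[k]_(5, 11)) (G : 'M[k]_(11, 5)) : V *m G = (2^-1)%:M ->
  V *m (2 *: G) = 1%:M.
  by move=> VG; rewrite -scalemxAr VG scale_scalar_mx mulfV.
have aSa : W1 *m Sa = 1%:M by apply: hS; rewrite mulmxA.
have bSb : b *m Sb = 1%:M by apply: hS; rewrite mulmxA.
have aSb : W1 *m Sb = 0 by rewrite -scalemxAr mulmxA aQa scaler0.
have bSa : b *m Sa = 0 by rewrite -scalemxAr mulmxA bQb scaler0.
have S1 : Sa *m W1 + Sb *m b + Sc *m e = 1%:M.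
  (* A right inverse of a square matrix is also a left inverse. *)
  have TS : col_mx (col_mx W1 b) e *m row_mx (row_mx Sa Sb) Sc = 1%:M.
    rewrite mul_col_row !mul_col_mx !mul_mx_row aSa aSb bSa bSb.
    rewrite -!scalemxAr !mulmxA eQa eQb aQe bQe eQe !scaler0.
    rewrite row_mx0 col_mx0 -[col_mx (row_mx _ _) (row_mx 0 _)]/(block_mx _ _ _ _).
    by rewrite -!scalar_mx_block.
  have : row_mx (row_mx Sa Sb) Sc *m col_mx (col_mx W1 b) e = 1%:M := mulmx1C TS.
  by rewrite !mul_row_col.
rewrite dE; exact: (spinor_zero_Fl numClosed_pchar0 Qsym polar aSa bSb aSb bSa
  S1 aQa bQb aQb eQb s1n d0 s1W se).
Qed.

End PurePair.

(** * Openness of the genericity conditions *)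

Section PolynomialFunctions.
Variables (k : fieldType) (N : nat).

Definition polyfun (f : 'rV[k]_N -> k) : Prop :=
  exists F : {mpoly k[N]}, forall x, f x = F.@[fun i => x 0 i].

Lemma polyfun_cst c : polyfun (fun=> c).
Proof. by exists c%:MP => x; rewrite mevalC. Qed.

Lemma polyfunD f g : polyfun f -> polyfun g -> polyfun (fun x => f x + g x).
Proof. by move=> [F fF] [G gG]; exists (F + G) => x; rewrite mevalD fF gG. Qed.

Lemma polyfunN f : polyfun f -> polyfun (fun x => - f x).
Proof. by move=> [F fF]; exists (- F) => x; rewrite mevalN fF. Qed.

Lemma polyfunM f g : polyfun f -> polyfun g -> polyfun (fun x => f x * g x).
Proof. by move=> [F fF] [G gG]; exists (F * G) => x; rewrite mevalM fF gG. Qed.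

Lemma polyfun_sum I (r : seq I) (f : I -> 'rV[k]_N -> k) :
  (forall i, polyfun (f i)) -> polyfun (fun x => \sum_(i <- r) f i x).
Proof.
move=> pfaffian; elim: r => [|i r IH].
  by have [F FE] := polyfun_cst 0; exists F => x; rewrite big_nil -FE.
by have [F FE] := polyfunD (pfaffian i) IH; exists F => x; rewrite big_cons -FE.
Qed.

Lemma polyfun_mulmx (M : 'M[k]_N) j : polyfun (fun x => (x *m M) 0 j).
Proof.
have [F FE] : polyfun (fun x => \sum_i x 0 i * M i j).
  apply: polyfun_sum => i; apply: polyfunM (polyfun_cst _).
  by exists 'X_i => x; rewrite mevalXU.
by exists F => x; rewrite mxE -FE.
Qed.

Variable x : 'rV[k]_N -> nat -> k.
Hypothesis px : forall i, polyfun (fun d => x d i).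

Ltac polyfun_tac := repeat first
  [exact: polyfun_cst | exact: px | apply: polyfunD | apply: polyfunN |
    apply: polyfunM].

Lemma polyfun_pfaffian : polyfun (fun d => pfaffian (x d)).
Proof. rewrite /pfaffian; polyfun_tac. Qed.

Lemma polyfun_sharp i : polyfun (fun d => sharp (x d) i).
Proof.
do 15? [case: i => [|i]; first by rewrite /sharp /=; polyfun_tac].
by rewrite /sharp /=; case: i => [|i]; exact: polyfun_cst.
Qed.

Lemma polyfun_coordB i : polyfun (fun d => coordB (x d) i).
Proof.
do 15? [case: i => [|i]; first by rewrite /coordB /=; polyfun_tac].
by rewrite /coordB /=; case: i => [|i]; exact: polyfun_cst.
Qed.

Lemma polyfun_coordC i : polyfun (fun d => coordC (x d) i).
Proof.
do 15? [case: i => [|i]; first by rewrite /coordC /=; polyfun_tac].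
by rewrite /coordC /=; case: i => [|i]; exact: polyfun_cst.
Qed.

End PolynomialFunctions.

Section PolynomialConditions.
Variables (k : fieldType) (N : nat) (x : 'rV[k]_N -> nat -> k).
Hypothesis px : forall i, polyfun (fun d => x d i).

Lemma polyfun_quarticD i : polyfun (fun d => quarticD (x d) i).
Proof.
rewrite /quarticD; apply: polyfunD; first exact: polyfunM (px _)
  (polyfun_coordC px i).
exact: polyfunN (polyfun_sharp (polyfun_coordB px) i).
Qed.

Lemma polyfun_quarticP : polyfun (fun d => quarticP (x d)).
Proof. exact: polyfun_pfaffian polyfun_quarticD. Qed.

Lemma polyfun_quarticE : polyfun (fun d => quarticE (x d)).
Proof.
rewrite /quarticE; apply: polyfunD; first apply: polyfunD.
- by apply: polyfunM (px _); rewrite /GRing.exp /=; apply: polyfunM.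
- exact: polyfunN (polyfun_pfaffian (polyfun_coordB px)).
apply: polyfunN; apply: polyfun_sum => i.
exact: polyfunM (polyfun_coordB px i) (polyfun_quarticD i).
Qed.

Lemma polyfun_quartic_disc : polyfun (fun d => quartic_disc (x d)).
Proof.
rewrite /quartic_disc; apply: polyfunD.
  exact: polyfunM (polyfun_cst _ _) polyfun_quarticP.
by rewrite /GRing.exp /=; apply: polyfunM; exact: polyfun_quarticE.
Qed.
End PolynomialConditions.

Section General.
Variables (k : numClosedFieldType) (Q : 'M[k]_11) (gam : 'I_11 -> 'M[k]_32).
Hypotheses (Qsym : Q^T = Q) (Qu : Q \in unitmx).
Hypothesis polar : forall u v : 'rV[k]_11,
  cliff gam u *m cliff gam v + cliff gam v *m cliff gam u =
    (2 * (u *m Q *m v^T) 0 0)%:M.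

Lemma skew6B (x y : nat -> k) i j : (i < 6)%N -> (j < 6)%N ->
  skew6 (fun l => x l - y l) i j = skew6 x i j - skew6 y i j.
Proof.
do 6? [case: i => [_|i]; first by do 6? [case: j => [_|j];
  first by rewrite /skew6 /=; ring]].
by [].
Qed.

Lemma hyperbolic_pair : exists a b : 'M[k]_(5, 11),
  [/\ a *m Q *m a^T = 0, b *m Q *m b^T = 0 & a *m Q *m b^T = (2^-1)%:M].
Proof.
have [T TQT] := orthonormal_basis Qsym Qu.
pose T1 := rowsub (lshift 6 : 'I_5 -> 'I_11) T.
pose T2 := rowsub (fun i : 'I_5 => rshift 5 (lshift 1 i) : 'I_11) T.
have TE (f g : 'I_5 -> 'I_11) : rowsub f T *m Q *m (rowsub g T)^T =
    \matrix_(i, j) (f i == g j)%:R.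
  apply/matrixP=> i j; rewrite -row_form !row_rowsub row_form TQT !mxE.
  by rewrite -[(f i == g j)%:R]/(1 *+ (f i == g j)).
have T11 : T1 *m Q *m T1^T = 1%:M.
  by rewrite TE; apply/matrixP=> i j; rewrite !mxE -!val_eqE.
have T22 : T2 *m Q *m T2^T = 1%:M.
  by rewrite TE; apply/matrixP=> i j; rewrite !mxE -!val_eqE /= eqn_add2l.
have T12 : T1 *m Q *m T2^T = 0.
  rewrite TE; apply/matrixP=> i j; rewrite !mxE -!val_eqE /= ltn_eqF //.
  exact: leq_trans (ltn_ord i) (leq_addr _ _).
have T21 : T2 *m Q *m T1^T = 0.
  rewrite TE; apply/matrixP=> i j; rewrite !mxE -!val_eqE /= gtn_eqF //.
  exact: leq_trans (ltn_ord j) (leq_addr _ _).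
have n2 : (2 : k) != 0 by rewrite pnatr_eq0.
(* Two orthonormal 5-tuples combined as (T1 + i T2) / 2 and (T1 - i T2) / 2 give isotropic spaces:
   (1 - 1) / 4 = 0, and their pairing is (1 + 1) / 4 = 1/2. *)
exists (2^-1 *: (T1 + 'i *: T2)), (2^-1 *: (T1 - 'i *: T2)).
have trZ c (F : 'M[k]_(5, 11)) : (c *: F)^T = c *: F^T by rewrite linearZ.
rewrite !trZ [(_ - _)^T]raddfB [(_ + _)^T]raddfD /= !trZ -!(scalemxAl, scalemxAr).
rewrite !(mulmxDl, mulmxDr, mulNmx, mulmxN) -!(scalemxAl, scalemxAr).
have ii (F : 'M[k]_5) : 'i *: ('i *: F) = - F by rewrite scalerA mulCii scaleN1r.
rewrite !ii T11 T12 T21 T22 !scaler0 !oppr0 !opprK !addr0 !add0r subrr !scaler0.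
split=> //; rewrite -mulr2n -[1%:M *+ 2]scaler_nat (scalerA _ 2) mulVf // scale1r.
exact: scalemx1.
Qed.

(** The X_i anticommute and square to zero, so from any nonzero spinor one multiplies successively
    by each X_m that does not already kill it. *)
Lemma killed_vector (a : 'M[k]_(5, 11)) : a *m Q *m a^T = 0 ->
  exists2 s : 'rV[k]_32, s != 0 & forall i, s *m cliff gam (row i a) = 0.
Proof.
move=> aQa; pose X i := cliff_row gam a i.
have XX i j : X i *m X j = - (X j *m X i).
  apply: (addIr (X j *m X i)); rewrite addNr polar row_form aQa mxE mulr0.
  exact: raddf0.
have X2 i : X i *m X i = 0.
  have /eqP := XX i i; rewrite -addr_eq0 -mulr2n -scaler_nat scaler_eq0.
  by rewrite pnatr_eq0 /= => /eqP.
suff kill m : exists2 s : 'rV[k]_32, s != 0 & forall i, (i < m)%N -> s *m X i = 0.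
  have [s s0 sX] := kill 5; exists s => // i.
  by have := sX i (ltn_ord i); rewrite /X /cliff_row inord_val.
elim: m => [|m [s s0 sX]].
  exists (delta_mx 0 0) => //; apply/eqP => /matrixP /(_ 0 0); rewrite !mxE eqxx.
  by move/eqP; rewrite oner_eq0.
have [sm|sm] := eqVneq (s *m X m) 0.
  by exists s => // i; rewrite ltnS leq_eqVlt => /orP[/eqP ->|/sX].
exists (s *m X m) => // i; rewrite ltnS leq_eqVlt => /orP[/eqP ->|im].
  by rewrite -mulmxA X2 mulmx0.
by rewrite -mulmxA XX mulmxN mulmxA sX // mul0mx oppr0.
Qed.

Section Decompose.
Variables (a b : 'M[k]_(5, 11)) (e : 'rV[k]_11) (s : 'rV[k]_32).
Hypotheses (aQa : a *m Q *m a^T = 0) (bQb : b *m Q *m b^T = 0).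
Hypotheses (aQb : a *m Q *m b^T = (2^-1)%:M).
Hypotheses (eQa : e *m Q *m a^T = 0) (eQb : e *m Q *m b^T = 0).
Hypotheses (eQe : e *m Q *m e^T = 1%:M).
Hypotheses (s_neq0 : s != 0) (sa : forall i, s *m cliff gam (row i a) = 0).
Hypothesis se : s *m cliff gam e = s.

Local Notation fk := (fock (cliff_row gam b) s).
Let k0 := numClosed_pchar0 k.
Let XY := cliff_row_ab k0 polar aQb.
Let YY := cliff_row_bb polar bQb.
Let Y0 := cliff_row_b2 k0 polar bQb.
Let EY := cliff_row_eb polar eQb.
Let sX i : (i < 5)%N -> s *m cliff_row gam a i = 0.
Proof. by move=> _; apply: sa. Qed.
Let sE : s *m cliff gam e = 1 *: s. Proof. by rewrite scale1r. Qed.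

Definition pure_col (x : nat -> k) : 'cV[k]_5 := \col_i skew6 x i 5.

Definition pure_mx (x : nat -> k) : 'M[k]_5 :=
  \matrix_(i, j) (skew6 x i j - skew6 x i 5 * skew6 x j 5).

Definition pure_space (x : nat -> k) : 'M[k]_(5, 11) :=
  a + pure_mx x *m b - pure_col x *m e.

Lemma pure_spaceP x i :
  fk (tree_of (pure_coord x) 5) *m cliff gam (row i (pure_space x)) = 0.
Proof.
have -> : row i (pure_space x) = delta_mx 0 i *m a + row i (pure_mx x) *m b
    + (- skew6 x i 5) *: e.
  rewrite /pure_space !raddfB !raddfD /= !row_mul -rowE scaleNr; congr (_ - _).
  by apply/rowP => j; rewrite !mxE big_ord1 !mxE.
rewrite cliff_coord; have := fock_op (m := 5) XY YY Y0 EY sX sE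
  (fun j => (delta_mx 0 i : 'rV[k]_5) 0 (inord j)) (fun j =>
    row i (pure_mx x) 0 (inord j))
  (- skew6 x i 5) (tree_of (pure_coord x) 5) (leqnn 5).
rewrite mulr1 => <-.
rewrite (@cliff_op_ext _ _ _ (fun j => (j == i)%:R)
  (fun j => skew6 x i j - skew6 x i 5 * skew6 x j 5)).
- by rewrite pure_killed // fock_cst0.
- by move=> j j5; rewrite mxE eqxx /= -val_eqE /= inordK.
- by move=> j j5; rewrite !mxE inordK.
Qed.

Lemma pure_neq0 x : fk (tree_of (pure_coord x) 5) != 0.
Proof.
apply/eqP; rewrite -(fock_cst0 (cliff_row gam b) s 5).
move/(fock_inj (m := 5) XY sX (leqnn 5) (s_free s_neq0)) => /= -[/eqP].
by rewrite oner_eq0.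
Qed.

(** Twice this pairing is the matrix of [skew_pairing_unit], with the last columns of x and y as its
    two vectors. *)
Lemma pure_space_pairing x y : pfaffian (fun j => x j - y j) != 0 ->
  pure_space x *m Q *m (pure_space y)^T \in unitmx.
Proof.
move=> pf0; pose z j := x j - y j.
have n2 : (2 : k) != 0 by rewrite pnatr_eq0.
have bQa : b *m Q *m a^T = (2^-1)%:M.
  by apply: trmx_inj; rewrite !trmx_mul trmxK Qsym mulmxA aQb tr_scalar_mx.
have aQe : a *m Q *m e^T = 0.
  by apply: trmx_inj; rewrite !trmx_mul trmxK Qsym mulmxA eQa trmx0.
have bQe : b *m Q *m e^T = 0.
  by apply: trmx_inj; rewrite !trmx_mul trmxK Qsym mulmxA eQb trmx0.
have E : pure_space x *m Q *m (pure_space y)^T =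
    2^-1 *: (pure_mx x + (pure_mx y)^T + 2 *: (pure_col x *m (pure_col y)^T)).
  have trE : (pure_space y)^T = a^T + b^T *m (pure_mx y)^T - e^T *m (pure_col y)^T.
    by rewrite /pure_space raddfB /= raddfD /= !trmx_mul.
  have ha : a *m Q *m (pure_space y)^T = 2^-1 *: (pure_mx y)^T.
    by rewrite trE mulmxBr mulmxDr !mulmxA aQa aQb aQe mul0mx subr0 add0r
      mul_scalar_mx.
  have hb : b *m Q *m (pure_space y)^T = (2^-1)%:M.
    by rewrite trE mulmxBr mulmxDr !mulmxA bQa bQb bQe !mul0mx subr0 addr0.
  have he : e *m Q *m (pure_space y)^T = - (pure_col y)^T.
    by rewrite trE mulmxBr mulmxDr !mulmxA eQa eQb eQe mul0mx mul1mx addr0 sub0r.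
  rewrite /pure_space !mulmxBl !mulmxDl -!(mulmxA (pure_mx x)) -!(mulmxA
    (pure_col x)).
  rewrite ha hb he mulmxN opprK mul_mx_scalar.
  by rewrite !scalerDr scalerA mulVf // scale1r [_ + 2^-1 *: pure_mx x]addrC.
have lt6 (i : 'I_5) : (i < 6)%N := ltnW (ltn_ord i).
have st i : pure_col x i 0 - pure_col y i 0 = skew6 z i 5.
  by rewrite !mxE skew6B.
have := skew_pairing_unit k0 pf0 st.
set K := (K in is_true (K \in _)) => Ku.
suff KE : pure_mx x + (pure_mx y)^T + 2 *: (pure_col x *m (pure_col y)^T) = K.
  by rewrite E KE unitmxZ // unitfE invr_eq0.
apply/matrixP => i j.
by rewrite !mxE big_ord1 !mxE skew6B // (skew6C y (lt6 j) (lt6 i)); ring.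
Qed.

End Decompose.

Lemma general_section_Fl : for_general (fun delta : 'rV[k]_32 =>
  isomorphic (spinor_zero Q gam delta) (Fl k 5)).
Proof.
have [a [b [aQa bQb aQb]]] := hyperbolic_pair.
have [s s_neq0 sa] := killed_vector aQa.
have [e [eQa eQb eQe se]] := hyperbolic_complement Qsym Qu polar bQb aQb s_neq0
  sa aQa.
have [M Mu Mfock] := fock_basis polar aQb s_neq0 sa.
pose v (x : 'rV[k]_32) (i : nat) : k := (x *m M) 0 (inord i).
have pv i : polyfun (fun x => v x i) by apply: polyfun_mulmx.
have [F FE] := polyfunM (polyfunM (pv 0%N) (polyfun_quarticP pv))
  (polyfun_quartic_disc pv).
exists [set x | v x 0%N * quarticP (v x) * quartic_disc (v x) != 0]%classic; split.
- exists [set F]%classic; apply/seteqP; split=> x /=.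
    by move=> nz; exists F => //; rewrite -FE.
  by move=> [_ -> nz]; rewrite FE.
- pose w : 'rV[k]_32 := \row_(i < 32) (nat_of_ord i \in [:: 0; 15; 19; 28])%N%:R.
  exists (w *m invmx M); rewrite /=.
  have vE i : (i < 32)%N -> v (w *m invmx M) i = (i \in [:: 0; 15; 19; 28])%N%:R.
    by move=> i32; rewrite /v mulmxKV // mxE inordK.
  have DE i : (i < 15)%N -> quarticD (v (w *m invmx M)) i = (i \in [:: 0; 9;
    14])%N%:R.
    do 15? [case: i => [_|i]; first by
      rewrite /quarticD /coordC /sharp /coordB /= !vE //=; ring].
    by [].
  have PE : quarticP (v (w *m invmx M)) = 1 by rewrite /quarticP /pfaffian !DE
    //=; ring.
  have EE : quarticE (v (w *m invmx M)) = 0.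
    rewrite /quarticE /dotB !big_ord_recl big_ord0 /pfaffian /coordB /= !vE //
      !DE //=; ring.
  rewrite /quartic_disc PE EE vE //= expr0n addr0 !mulr1 mul1r pnatr_eq0 //.
move=> x /=; rewrite !mulf_eq0 !negb_or -andbA => /and3P[v0 P0 R0].
have [l [m [y [z [l0 m0 pf0 vE]]]]] :=
  pure_decomposition (numClosed_pchar0 k) v0 P0 R0 (sqrtCK _).
pose s1 := l *: fock (cliff_row gam b) s (tree_of (pure_coord y) 5).
pose s2 := m *: fock (cliff_row gam b) s (tree_of (pure_coord z) 5).
have -> : x = s1 + s2.
  rewrite [x]Mfock /s1 /s2 -!fock_scale -fock_add; congr (fock _ _ _).
  rewrite -!tree_of_scale -tree_of_add.
  exact: tree_of_ext.
have pure0 c (u : nat -> k) : c != 0 -> c *: fock (cliff_row gam b) s (tree_of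
  (pure_coord u) 5) != 0.
  by move=> c0; rewrite scaler_eq0 (negPf c0) (negPf (pure_neq0 aQb s_neq0 sa u)).
apply: (pure_pair_iso Qsym Qu polar (W1 := pure_space a b e y) (W2 :=
  pure_space a b e z)).
- exact: pure0.
- exact: pure0.
- by move=> i; rewrite -scalemxAl (pure_spaceP bQb aQb eQb sa se) scaler0.
- by move=> i; rewrite -scalemxAl (pure_spaceP bQb aQb eQb sa se) scaler0.
- exact: (pure_space_pairing aQa bQb aQb eQa eQb eQe pf0).
Qed.
End General.

Lemma cliff_polarization (k : fieldType) n N (Q : 'M[k]_n) (gam : 'I_n -> 'M[k]_N) :
  Q^T = Q -> (forall v : 'rV[k]_n, cliff gam v *m cliff gam v = (quad Q v)%:M) ->
  forall u v : 'rV[k]_n, cliff gam u *m cliff gam v + cliff gam v *m cliff gam u =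
    (2 * (u *m Q *m v^T) 0 0)%:M.
Proof.
move=> Qsym cl u v.
have DE (F G : 'M[k]_1) : (F + G) 0 0 = F 0 0 + G 0 0 by rewrite mxE.
have vu : v *m Q *m u^T = u *m Q *m v^T.
  have T1 (F : 'M[k]_1) : F^T = F by apply/matrixP=> i j; rewrite mxE !ord1.
  by rewrite -[LHS]T1 !trmx_mul !trmxK Qsym mulmxA.
have := cl (u + v); rewrite linearD /= mulmxDl !mulmxDr !cl /quad linearD /=.
rewrite !mulmxDl !mulmxDr !DE vu !raddfD /= => E.
apply: (addrI (((u *m Q *m u^T) 0 0)%:M)).
apply: (addIr (((v *m Q *m v^T) 0 0)%:M)).
rewrite !addrA in E *; rewrite E mulr_natl mulr2n raddfD /= !addrA.
by [].
Qed.

Theorem proposition21 (R : realType)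
    (Q : 'M[R[i]]_11) (Qsym : Q^T = Q) (Qnondeg : Q \in unitmx)
    (gam : 'I_11 -> 'M[R[i]]_32) (Delta_spin : spin_module Q gam) :
  for_general (fun delta : 'rV[R[i]]_32 =>
    isomorphic (spinor_zero Q gam delta) (Fl _ 5)).
Proof.
exact: general_section_Fl Qsym Qnondeg (cliff_polarization Qsym Delta_spin.1).
Qed.
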